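(* Let $\tilde w=s_{\beta_1}\cdots s_{\beta_r}$ be an expression (not necessarily reduced) in simple reflections of the Weyl group of a Kac-Moody group $G$. Then the toric limit $Y_{\tilde w}$ of the Bott-Samelson-Demazure-Hansen variety $Z(\tilde w)$ is a Bott tower.
   Context: We work over $\mathbb C$. $G$ is the Kac-Moody group of a generalized Cartan matrix, with maximal torus $T$, Borel subgroup $B\supset T$, simple roots $S$, minimal parabolic subgroups $P_\alpha$ ($\alpha\in S$). An expression is a finite sequence $\tilde w=s_{\beta_1}\cdots s_{\beta_r}$ of simple reflections, $\beta_i\in S$. Put $\beta_{ij}:=\langle\beta_j,\check\beta_i\rangle$, where $\check\beta_i$ is the coroot of $\beta_i$. $Z(\tilde w)=P_{\beta_1}\times\cdots\times P_{\beta_r}/B^r$ with action $(p_1,\dots,p_r)\cdot(b_1,\dots,b_r)=(p_1b_1,b_1^{-1}p_2b_2,\dots,b_{r-1}^{-1}p_rb_r)$. Toric limit: choose an injective one-parameter subgroup $\lambda:\mathbb G_m\to T$ and $q>0$ with $\alpha(\lambda(u))=u^q$ for all $\alpha\in S$; let $\Psi_u(b)=\lambda(u)b\lambda(u)^{-1}$ for $u\ne0$, $b\in B$, extended to $u=0$ by the projection $\Psi_0:B\to T$. Let $\mathcal X=\mathbb A^1\times P_{\beta_1}\times\cdots\times P_{\beta_r}/B^r$ with action $(u,p_1,\dots,p_r)\cdot(b_1,\dots,b_r)=(u,p_1b_1,\Psi_u(b_1)^{-1}p_2b_2,\dots,\Psi_u(b_{r-1})^{-1}p_rb_r)$. $Y_{\tilde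 w}$ is the fibre over $0$ of the projection $\mathcal X\to\mathbb A^1$. It is the smooth projective toric variety whose fan in $\mathbb R^r$ is as follows (known): with $e_1^+,\dots,e_r^+$ the standard basis of $\mathbb Z^r$ and $e_i^-:=-e_i^+-\sum_{j>i}\beta_{ij}e_j^+$, the cones are those generated by subsets of $\{e_1^{\pm},\dots,e_r^{\pm}\}$ containing no pair $\{e_i^+,e_i^-\}$. A Bott tower of height $r$ is a sequence of projective bundles $Y_r\to Y_{r-1}\to\cdots\to Y_1=\mathbb P^1\to Y_0=\{pt\}$ with $Y_i=\mathbb P(\mathcal O_{Y_{i-1}}\oplus\mathcal L_{i-1})$ for a line bundle $\mathcal L_{i-1}$ on $Y_{i-1}$, $1\le i\le r$; a variety is called a Bott tower if it is the top stage $Y_r$ of such a sequence. *)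

(* Defs.v *)
From HB Require Import structures.
From mathcomp Require Import all_boot all_order all_algebra.
From mathcomp Require Import all_classical all_reals all_analysis.
From mathcomp Require Import complex.
Set Implicit Arguments.
Unset Strict Implicit.
Unset Printing Implicit Defensive.
Import GRing.Theory.
Local Open Scope classical_set_scope.
Local Open Scope ring_scope.

(******************************************************************************)
(* Varieties are handled in the category of spaces with functions (Serre,     *)
(* Kempf): a topological space with a sheaf of K-valued functions, closed     *)
(* under inversion where a function does not vanish.  For K algebraically     *)
(* closed, varieties over K are a full subcategory, and products, subvarieties*)
(* and quotients with local sections agree with those taken here.             *)
(******************************************************************************)

(* [reg U f]: U is open and f is a regular function on U; the values of f
   outside U do not matter, by [reg_glue]. *)
Record fspace (K : fieldType) := FSpace {
  pt :> topologicalType;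
  reg : set pt -> (pt -> K) -> Prop;
  reg_open : forall U f, reg U f -> open U;
  reg_glue : forall (U : set pt) f, open U ->
    (forall x, U x -> exists V g,
       [/\ reg V g, V x & forall y, V y -> U y -> f y = g y]) -> reg U f;
  reg_sub : forall (U V : set pt) f, reg U f -> open V -> V `<=` U -> reg V f;
  reg_cst : forall c, reg setT (fun=> c);
  reg_add : forall U f g, reg U f -> reg U g -> reg U (fun x => f x + g x);
  reg_mul : forall U f g, reg U f -> reg U g -> reg U (fun x => f x * g x);
  reg_inv : forall U f, reg U f ->
    reg (U `&` [set x | f x != 0]) (fun x => (f x)^-1)
}.

Section Morphisms.
Variable K : fieldType.
Implicit Types X Y : fspace K.

(* For A open in X: f is a morphism from the open subspace A of X to Y. *)
Definition morph_on X Y (A : set X) (f : X -> Y) : Prop :=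
  (forall V : set Y, open V -> open (A `&` f @^-1` V)) /\
  (forall (V : set Y) h, reg V h -> reg (A `&` f @^-1` V) (h \o f)).

(* For A and B open: f restricts to an isomorphism from A to B. *)
Definition iso_on X Y (A : set X) (B : set Y) (f : X -> Y) : Prop :=
  exists g : Y -> X,
    [/\ morph_on A f, morph_on B g,
        forall x, A x -> B (f x) /\ g (f x) = x
      & forall y, B y -> A (g y) /\ f (g y) = y].

End Morphisms.

(* The coarsest structure on T in which U is open and f is regular on U whenever
   [F U f].  Its instances are the affine spaces (global generators), products
   and subspaces. *)
Section Initial.
Variables (K : fieldType) (T : Type).
Implicit Type F : set T -> (T -> K) -> Prop.

Inductive gen F : set T -> (T -> K) -> Prop :=
| gen_base U f : F U f -> gen F U f
| gen_cst c : gen F setT (fun=> c)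
| gen_add U V f g :
    gen F U f -> gen F V g -> gen F (U `&` V) (fun x => f x + g x)
| gen_mul U V f g :
    gen F U f -> gen F V g -> gen F (U `&` V) (fun x => f x * g x)
| gen_inv U f : gen F U f ->
    gen F (U `&` [set x | f x != 0]) (fun x => (f x)^-1).

Definition init_pt F : Type := T.

Variable F : set T -> (T -> K) -> Prop.
Local Notation P := (init_pt F).

HB.instance Definition _ := gen_eqMixin P.
HB.instance Definition _ := gen_choiceMixin P.

Definition init_open : set_system P := [set W : set P |
  forall x, W x -> exists U f, [/\ gen F U f, U x & U `<=` W]].

Lemma init_openT : init_open setT.
Proof. by move=> x _; exists setT, (fun=> 0); split=> //; exact: gen_cst. Qed.

Lemma init_openI : setI_closed init_open.
Proof.
move=> A B oA oB x [Ax Bx].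
have [U [f [gf Ux UA]]] := oA x Ax; have [V [g [gg Vx VB]]] := oB x Bx.
exists (U `&` V), (fun y => f y + g y); split=> //; first exact: gen_add.
exact: setISS.
Qed.

Lemma init_open_bigU (I : Type) (f : I -> set P) :
  (forall i, init_open (f i)) -> init_open (\bigcup_i f i).
Proof.
move=> of_ x [i _ fx]; have [U [g [gg Ux Uf]]] := of_ i x fx.
by exists U, g; split=> // y Uy; exists i => //; exact: Uf.
Qed.

HB.instance Definition _ :=
  isOpenTopological.Build P init_openT init_openI init_open_bigU.

Definition init_reg (W : set P) (f : P -> K) : Prop :=
  open W /\ forall x, W x -> exists U g,
    [/\ gen F U g, U x, U `<=` W & forall y, U y -> f y = g y].

Lemma gen_restr U V f g : gen F U f -> gen F V g -> gen F (U `&` V) f.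
Proof.
move=> gf gg.
have -> : f = (fun x => f x + 0 * g x).
  by apply/funext => x; rewrite mul0r addr0.
rewrite -[V in U `&` V]setTI; apply: gen_add => //.
by apply: gen_mul => //; exact: gen_cst.
Qed.

Lemma gen_open U f : gen F U f -> @open P U.
Proof.
by move=> gf; suff : init_open U by []; move=> x Ux; exists U, f; split=> // y.
Qed.

Lemma init_reg_open W f : init_reg W f -> open W. Proof. by case. Qed.

Lemma init_reg_glue (U : set P) f : open U ->
  (forall x, U x -> exists V g,
     [/\ init_reg V g, V x & forall y, V y -> U y -> f y = g y]) ->
  init_reg U f.
Proof.
move=> oU H; split=> // x Ux; have [V [g [[oV gV] Vx fg]]] := H x Ux.
have [W [h [gh Wx WV gh']]] := gV x Vx; have [W' [h' [gW' W'x W'U]]] := oU x Ux.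
exists (W `&` W'), h; split=> //; first exact: gen_restr gh gW'.
  by move=> y [_ /W'U].
by move=> y [Wy W'y]; rewrite fg ?gh' //; [exact: WV|exact: W'U].
Qed.

Lemma init_reg_sub (U V : set P) f :
  init_reg U f -> open V -> V `<=` U -> init_reg V f.
Proof.
move=> rf oV VU; apply: init_reg_glue => // x Vx.
by exists U, f; split=> //; exact: VU.
Qed.

Lemma init_reg_cst c : init_reg setT (fun=> c).
Proof.
split; first exact: init_openT.
by move=> x _; exists setT, (fun=> c); split=> //; exact: gen_cst.
Qed.

Lemma init_reg_add U f g :
  init_reg U f -> init_reg U g -> init_reg U (fun x => f x + g x).
Proof.
move=> [oU rf] [_ rg]; split=> // x Ux.
have [V [f' [gf Vx VU ff]]] := rf x Ux; have [W [g' [gg Wx WU gg']]] := rg x Ux.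
exists (V `&` W), (fun x => f' x + g' x); split=> //; first exact: gen_add.
  by move=> y [/VU].
by move=> y [Vy Wy]; rewrite ff ?gg'.
Qed.

Lemma init_reg_mul U f g :
  init_reg U f -> init_reg U g -> init_reg U (fun x => f x * g x).
Proof.
move=> [oU rf] [_ rg]; split=> // x Ux.
have [V [f' [gf Vx VU ff]]] := rf x Ux; have [W [g' [gg Wx WU gg']]] := rg x Ux.
exists (V `&` W), (fun x => f' x * g' x); split=> //; first exact: gen_mul.
  by move=> y [/VU].
by move=> y [Vy Wy]; rewrite ff ?gg'.
Qed.

Lemma init_reg_inv U f : init_reg U f ->
  init_reg (U `&` [set x | f x != 0]) (fun x => (f x)^-1).
Proof.
move=> [oU rf].
have H x : (U `&` [set x | f x != 0]) x -> exists V g,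
    [/\ gen F V g, V x, V `<=` U `&` [set x | f x != 0]
      & forall y, V y -> (f y)^-1 = g y].
  move=> [Ux /= fx0]; have [V [f' [gf Vx VU ff]]] := rf x Ux.
  exists (V `&` [set x | f' x != 0]), (fun x => (f' x)^-1); split.
  - exact: gen_inv.
  - by split=> //=; rewrite -ff.
  - by move=> y [Vy /= fy]; split; [exact: VU|rewrite /= ff].
  - by move=> y [Vy _]; rewrite ff.
split=> //; suff : init_open (U `&` [set x | f x != 0]) by [].
by move=> x Ux; have [V [g [gg Vx VU _]]] := H x Ux; exists V, g; split.
Qed.

Definition initial_space : fspace K :=
  FSpace init_reg_open init_reg_glue init_reg_sub init_reg_cst init_reg_add
    init_reg_mul init_reg_inv.

End Initial.

(* The finest structure on the set of classes of an equivalence relation R making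
   the projection [qproj] a morphism; classes are the sets [R x]. *)
Section Quotient.
Variables (K : fieldType) (X : fspace K).

Definition quot_pt (R : X -> set X) : Type := {A : set X | exists x, A = R x}.

Variable R : X -> set X.
Local Notation Q := (quot_pt R).

HB.instance Definition _ := gen_eqMixin Q.
HB.instance Definition _ := gen_choiceMixin Q.

Definition qproj (x : X) : Q := exist _ (R x) (ex_intro _ x erefl).

Definition quot_open : set_system Q := [set W : set Q | open (qproj @^-1` W)].

Lemma quot_openT : quot_open setT. Proof. exact: openT. Qed.

Lemma quot_openI : setI_closed quot_open.
Proof. by move=> A B oA oB; exact: openI. Qed.

Lemma quot_open_bigU (I : Type) (f : I -> set Q) :
  (forall i, quot_open (f i)) -> quot_open (\bigcup_i f i).
Proof.
move=> of_; rewrite /quot_open /= preimage_bigcup.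
by apply: bigcup_open => i _; exact: of_.
Qed.

HB.instance Definition _ :=
  isOpenTopological.Build Q quot_openT quot_openI quot_open_bigU.

Definition quot_reg (W : set Q) (f : Q -> K) : Prop :=
  reg (qproj @^-1` W) (f \o qproj).

Lemma quot_reg_open W f : quot_reg W f -> open W.
Proof. exact: reg_open. Qed.

Lemma quot_reg_glue (U : set Q) f : open U ->
  (forall x, U x -> exists V g,
     [/\ quot_reg V g, V x & forall y, V y -> U y -> f y = g y]) ->
  quot_reg U f.
Proof.
move=> oU H; apply: reg_glue => // x Ux.
have [V [g [rg Vx fg]]] := H _ Ux.
by exists (qproj @^-1` V), (g \o qproj); split=> // y Vy Uy; exact: fg.
Qed.

Lemma quot_reg_sub (U V : set Q) f :
  quot_reg U f -> open V -> V `<=` U -> quot_reg V f.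
Proof. by move=> rf oV VU; apply: reg_sub rf _ _ => // x; exact: VU. Qed.

Lemma quot_reg_cst c : quot_reg setT (fun=> c).
Proof. exact: reg_cst. Qed.

Lemma quot_reg_add U f g :
  quot_reg U f -> quot_reg U g -> quot_reg U (fun x => f x + g x).
Proof. exact: reg_add. Qed.

Lemma quot_reg_mul U f g :
  quot_reg U f -> quot_reg U g -> quot_reg U (fun x => f x * g x).
Proof. exact: reg_mul. Qed.

Lemma quot_reg_inv U f : quot_reg U f ->
  quot_reg (U `&` [set x | f x != 0]) (fun x => (f x)^-1).
Proof. exact: reg_inv. Qed.

Definition quot_space : fspace K :=
  FSpace quot_reg_open quot_reg_glue quot_reg_sub quot_reg_cst quot_reg_add
    quot_reg_mul quot_reg_inv.

End Quotient.

Section Constructions.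
Variable K : fieldType.

Definition affine_space (T : Type) (Fs : set (T -> K)) : fspace K :=
  initial_space (fun U f => U = setT /\ Fs f).

Definition subspace_of (X : fspace K) (A : set X) : fspace K :=
  initial_space (fun (U : set {x : X | A x}) f => exists V g,
    [/\ @reg K X V g, U = sval @^-1` V & f = g \o sval]).

Definition prod_space (X Y : fspace K) : fspace K :=
  initial_space (fun (U : set (X * Y)) f =>
    (exists V g, [/\ @reg K X V g, U = fst @^-1` V & f = g \o fst]) \/
    (exists V g, [/\ @reg K Y V g, U = snd @^-1` V & f = g \o snd])).

Definition point_space : fspace K := affine_space (set0 : set (unit -> K)).

Definition punctured_plane : fspace K :=
  affine_space [set f : {v : K * K | v <> (0, 0)} -> K |
            f = fst \o sval \/ f = snd \o sval].

Definition collinear (v : punctured_plane) : set punctured_plane :=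
  [set v' | exists2 c : K, c != 0 &
     sval v' = (c * (sval v).1, c * (sval v).2)].

Definition P1 : fspace K := quot_space collinear.

End Constructions.

Section BottTower.
Variable K : fieldType.

(* A line bundle, presented by an open cover and the transition functions of
   its trivializations. *)
Record line_bundle (Y : fspace K) := LineBundle {
  lb_idx : Type;
  lb_dom : lb_idx -> set Y;
  lb_tr : lb_idx -> lb_idx -> Y -> K;
  lb_open : forall i, open (lb_dom i);
  lb_cover : forall y, exists i, lb_dom i y;
  lb_reg : forall i j, reg (lb_dom i `&` lb_dom j) (lb_tr i j);
  lb_id : forall i y, lb_dom i y -> lb_tr i i y = 1;
  lb_cocycle : forall i j k y, lb_dom i y -> lb_dom j y -> lb_dom k y ->
    lb_tr i j y * lb_tr j k y = lb_tr i k y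
}.

(* p : E -> Y is the projective bundle P(O + L): the trivializations over the
   lb_dom i are glued by [a : b] |-> [a : g_ij b], g_ij the cocycle of L.
   Replacing L by its dual gives an isomorphic bundle, so that the choice between
   lines and hyperplanes in P(O + L) is immaterial for Bott towers. *)
Definition is_proj_bundle (Y : fspace K) (L : line_bundle Y)
    (E : fspace K) (p : E -> Y) : Prop :=
  exists phi : lb_idx L -> E -> P1 K,
    (forall i, @iso_on K E (prod_space Y (P1 K)) (p @^-1` lb_dom i)
       (lb_dom i `*` setT) (fun e => (p e, phi i e))) /\
    (forall i j e (v v' : punctured_plane K),
       lb_dom i (p e) -> lb_dom j (p e) ->
       phi j e = qproj _ v ->
       sval v' = ((sval v).1, lb_tr i j (p e) * (sval v).2) ->
       phi i e = qproj _ v').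

(* [bott_tower r X]: X is the top stage of a Bott tower of height r. *)
Inductive bott_tower : nat -> fspace K -> Prop :=
| BottPoint (X : fspace K) (f : X -> point_space K) :
    iso_on setT setT f -> bott_tower 0 X
| BottStage r (Y : fspace K) (L : line_bundle Y) (E : fspace K) (p : E -> Y) :
    bott_tower r Y -> is_proj_bundle L p -> bott_tower r.+1 E.

End BottTower.

Definition is_gcm (S : finType) (A : S -> S -> int) : Prop :=
  [/\ forall i, A i i = 2,
      forall i j, i != j -> A i j <= 0
    & forall i j, A i j = 0 -> A j i = 0].

(* A realization of a generalized Cartan matrix over a torus of rank n: both the
   character and the cocharacter lattices are Z^n, and
   cartan i j = <alpha_j, alpha_i^vee>. *)
Record root_datum := RootDatum {
  simple : finType;
  cartan : simple -> simple -> int;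
  rdim : nat;
  simple_root : simple -> 'rV[int]_rdim;
  simple_coroot : simple -> 'rV[int]_rdim;
  cartanP : is_gcm cartan;
  cartanE : forall i j, cartan i j = \sum_k simple_root j 0 k * simple_coroot i 0 k
}.

Section Torus.
Variables (K : fieldType) (n : nat).

Definition torus : set ('I_n -> K) := [set t | forall k, t k != 0].
Definition character (m : 'rV[int]_n) (t : 'I_n -> K) : K :=
  \prod_k t k ^ m 0 k.
Definition cochar (m : 'rV[int]_n) (z : K) : 'I_n -> K := fun k => z ^ m 0 k.

(* SL_2 x T *)
Definition sl2_torus : fspace K :=
  affine_space [set f : {x : 'M[K]_2 * ('I_n -> K) | \det x.1 = 1 /\ torus x.2} -> K |
    (exists i j, f = fun x => (sval x).1 i j) \/
    (exists k, f = fun x => (sval x).2 k)].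

End Torus.

Section Matrices.
Variable K : fieldType.
Definition mx22 (a b c d : K) : 'M[K]_2 :=
  \matrix_(i, j) if i == 0 then (if j == 0 then a else b)
                 else (if j == 0 then c else d).
Definition upper (c : K) := mx22 1 c 0 1.
Definition lower (c : K) := mx22 1 0 c 1.
Definition weyl2 := mx22 0 1 (-1) 0.
Definition diag2 (z : K) := mx22 z 0 0 z^-1.
End Matrices.

Definition is_subgroup (G : groupType) (H : set G) : Prop :=
  H 1%g /\ forall x y, H x -> H y -> H (x * y^-1)%g.

Section KacMoody.
Local Open Scope group_scope.
Variables (K : fieldType) (D : root_datum).

(* [tor] parametrizes the maximal torus T; [sl2 a] is the homomorphism from SL_2
   attached to the simple root a, used on matrices of determinant 1 only; [unip]
   is the unipotent radical U of B; [coord a] is the coordinate ring of the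
   minimal parabolic P_a, its elements being used on P_a only. *)
Record km_data := KMData {
  km_carrier :> groupType;
  tor : ('I_(rdim D) -> K) -> km_carrier;
  sl2 : simple D -> 'M[K]_2 -> km_carrier;
  unip : set km_carrier;
  coord : simple D -> set (km_carrier -> K)
}.

Arguments tor G _ : clear implicits, rename.
Arguments sl2 G _ _ : clear implicits, rename.
Arguments unip G _ : clear implicits, rename.
Arguments coord G _ _ : clear implicits, rename.

Section Subgroups.
Variable G : km_data.

Definition maxtorus : set G := tor G @` @torus K (rdim D).
Definition borel : set G := [set t * u | t in maxtorus & u in unip G].
Definition srefl (a : simple D) : G := sl2 G a (weyl2 K).

(* P_a = B \cup B s_a B *)
Definition minpar (a : simple D) : set G :=
  [set g | borel g \/
     exists b b', [/\ borel b, borel b' & g = b * srefl a * b']].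

(* P_a = L_a |x U_a with U_a = U \cap s_a U s_a^-1 *)
Definition levi (a : simple D) : set G :=
  [set x * t | x in sl2 G a @` [set M | \det M = 1%R] & t in maxtorus].
Definition rad (a : simple D) : set G :=
  [set u | unip G u /\ unip G ((srefl a)^-1 * u * srefl a)].

(* f(M, t) for f a function on L_a, pulled back to SL_2 x T *)
Definition levi_pull (a : simple D) (f : G -> K) : sl2_torus K (rdim D) -> K :=
  fun x => f (sl2 G a (sval x).1 * tor G (sval x).2).

End Subgroups.

Arguments maxtorus G _ : clear implicits.
Arguments borel G _ : clear implicits.
Arguments srefl G _ : clear implicits.
Arguments minpar G _ _ : clear implicits.
Arguments levi G _ _ : clear implicits.
Arguments rad G _ _ : clear implicits.
Arguments levi_pull G _ _ _ : clear implicits.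

(* The structure of a Kac-Moody group with its minimal parabolic subgroups as
   (pro-)algebraic groups, as in Kumar, "Kac-Moody groups, their flag varieties
   and representation theory", Chapter VI.  It is valid for the completed group
   (P_a a pro-algebraic group, U = exp of the completed positive part) as well as
   for the minimal one (coordinate rings spanned by matrix coefficients of
   integrable highest weight modules). *)
Record km_axioms (G : km_data) : Prop := KMAxioms {
  torM : forall s t, torus s -> torus t ->
    tor G (fun k => s k * t k)%R = tor G s * tor G t;
  tor_inj : forall s t, torus s -> torus t -> tor G s = tor G t -> s = t;
  sl2M : forall a M N, (\det M = 1)%R -> (\det N = 1)%R ->
    sl2 G a (M *m N)%R = sl2 G a M * sl2 G a N;
  sl2_diag : forall a z, z != 0%R ->
    sl2 G a (diag2 z) = tor G (cochar (simple_coroot a) z);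
  sl2_tor : forall a M, (\det M = 1)%R -> maxtorus G (sl2 G a M) ->
    is_diag_mx M;
  tor_upper : forall a t c, torus t ->
    tor G t * sl2 G a (upper c) * (tor G t)^-1 =
    sl2 G a (upper (character (simple_root a) t * c)%R);
  tor_lower : forall a t c, torus t ->
    tor G t * sl2 G a (lower c) * (tor G t)^-1 =
    sl2 G a (lower ((character (simple_root a) t)^-1 * c)%R);
  (* B = T |x U *)
  unip_group : is_subgroup (unip G);
  unip_norm : forall t u, maxtorus G t -> unip G u -> unip G (t * u * t^-1);
  unip_tor : forall t, maxtorus G t -> unip G t -> t = 1;
  (* U = U_a-root-subgroup |x U_a  and  P_a = L_a |x U_a *)
  unip_root : forall a,
    unip G = [set sl2 G a (upper c) * u | c in setT & u in rad G a];
  minpar_group : forall a, is_subgroup (minpar G a);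
  minpar_levi : forall a,
    minpar G a = [set l * u | l in levi G a & u in rad G a];
  rad_norm : forall a p u, minpar G a p -> rad G a u -> rad G a (p * u * p^-1);
  levi_rad : forall a l, levi G a l -> rad G a l -> l = 1 :> G;
  (* G is generated by the minimal parabolic subgroups (and B) *)
  km_gen : forall H : set G, is_subgroup H -> borel G `<=` H ->
    (forall a, minpar G a `<=` H) -> H = setT;
  (* K[P_a] is a Hopf algebra of functions on P_a *)
  coord_ext : forall a f g, coord G a f -> {in minpar G a, f =1 g} ->
    coord G a g;
  coord_cst : forall a c, coord G a (fun=> c);
  coord_add : forall a f g, coord G a f -> coord G a g ->
    coord G a (fun p => f p + g p)%R;
  coord_mul : forall a f g, coord G a f -> coord G a g ->
    coord G a (fun p => f p * g p)%R;
  coord_sep : forall a p q, minpar G a p -> minpar G a q ->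
    (forall f, coord G a f -> f p = f q) -> p = q;
  coord_comul : forall a f, coord G a f ->
    exists s : seq ((G -> K) * (G -> K)),
      (forall i : 'I_(size s), coord G a (tnth (in_tuple s) i).1 /\
                               coord G a (tnth (in_tuple s) i).2) /\
      forall p q, minpar G a p -> minpar G a q ->
        f (p * q) = (\sum_(h <- s) h.1 p * h.2 q)%R;
  coord_antipode : forall a f, coord G a f -> coord G a (fun p => f p^-1);
  (* B inherits the same structure from every P_a *)
  coord_borel : forall a b f, coord G a f ->
    exists2 g, coord G b g & {in borel G, f =1 g};
  (* L_a, the quotient of SL_2 x T by the kernel of the multiplication map, is a
     closed subgroup of P_a, and P_a / U_a = L_a as algebraic groups *)
  coord_levi : forall a f, coord G a f -> reg setT (levi_pull G a f);
  coord_proj : forall a f,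
    (forall p u, minpar G a p -> rad G a u -> f (p * u) = f p) ->
    reg setT (levi_pull G a f) -> coord G a f;
  (* the roots of U are non-zero sums of simple roots: the weights of T acting on
     K[U] by conjugation are such sums, except on the constants *)
  coord_weight : forall a f, coord G a f ->
    exists s : seq ((simple D -> nat) * (G -> K)),
      (forall i : 'I_(size s), let h := tnth (in_tuple s) i in
         coord G a h.2 /\ exists b, (0 < h.1 b)%N) /\
      forall t u, torus t -> unip G u ->
        f (tor G t * u * (tor G t)^-1) =
        (f 1%g + \sum_(h <- s)
                   (\prod_b character (simple_root b) t ^+ h.1 b) * h.2 u)%R
}.

Record km_group := KMGroup {
  km_data_of :> km_data;
  km_axiomsP : km_axioms km_data_of
}.

End KacMoody.

Arguments tor {K D} G _ : rename.
Arguments sl2 {K D} G _ _ : rename.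
Arguments unip {K D} G _ : rename.
Arguments coord {K D} G _ _ : rename.
Arguments maxtorus {K D} G _.
Arguments borel {K D} G _.
Arguments srefl {K D} G _.
Arguments minpar {K D} G _ _.
Arguments levi {K D} G _ _.
Arguments rad {K D} G _ _.
Arguments levi_pull {K D} G _ _ _.

Section ToricLimit.
Local Open Scope group_scope.
Variables (K : fieldType) (D : root_datum) (G : km_group K D).
Variable lambda : 'rV[int]_(rdim D).  (* the one-parameter subgroup *)

(* The projection B -> T, t * u |-> t *)
Definition borel_tor (b : G) : G :=
  xget 1 [set t | maxtorus G t /\ unip G (t^-1 * b)].

Definition Psi (u : K) (b : G) : G :=
  if u == 0%R then borel_tor b
  else tor G (cochar lambda u) * b * (tor G (cochar lambda u))^-1.

Variables (r : nat) (w : r.-tuple (simple D)).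

(* A^1 x P_{beta_1} x ... x P_{beta_r} *)
Definition family_cover : fspace K :=
  affine_space [set f : {x : K * ('I_r -> G) | forall k, minpar G (tnth w k) (x.2 k)}
                  -> K |
            f = fst \o sval \/
            exists k h, coord G (tnth w k) h /\ f = fun x => h ((sval x).2 k)].

(* The orbits of the twisted action of B^r; only the first r terms of the
   sequence b enter. *)
Definition family_orbit (x : family_cover) : set family_cover :=
  [set y | exists b : nat -> G,
     [/\ forall k, borel G (b k), (sval y).1 = (sval x).1
       & forall k : 'I_r, (sval y).2 k =
           (if val k is j.+1 then Psi (sval x).1 (b j) else 1)^-1
             * (sval x).2 k * b k]].

Definition toric_family : fspace K := quot_space family_orbit.

Definition family_proj (x : toric_family) : K :=
  xget 0%R [set u | exists2 y, qproj family_orbit y = x & (sval y).1 = u].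

Definition toric_limit : fspace K :=
  subspace_of (family_proj @^-1` [set 0%R]).

End ToricLimit.

(* Main.v *)
(* Write X for the family over A^1 and C for its cover A^1 x P_1 x ... x P_r.  A
   local section of C -> X for the first r factors comes with the last component
   b : C -> B of the element of B^r relating a point to the section, and
   (u, p_1, ..., p_r, p) |-> Psi_u(b) p B in P_alpha / B = P^1 identifies the family
   for r+1 factors locally with X x P^1; the two standard charts of P^1 then give
   the local sections for r+1 factors.  At u = 0 only the torus part of b acts, so
   two such identifications differ by a diagonal matrix, whose entry
   alpha(t)^-1 alpha(t') is the cocycle of a line bundle.

   Regularity of Psi at u = 0: f(Psi_u(b)) is a polynomial in u for b in B, since
   the weights of T on K[U] are sums of simple roots; its coefficients are
   combinations of the functions b |-> f(Psi_z(b)) with z != 0, which are translates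
   of f. *)
Require Import Defs.
From HB Require Import structures.
From mathcomp Require Import all_boot all_order all_algebra.
From mathcomp Require Import all_classical all_reals all_analysis.
From mathcomp Require Import complex ring qpoly.
Set Implicit Arguments.
Unset Strict Implicit.
Unset Printing Implicit Defensive.
Import GRing.Theory.
Local Open Scope classical_set_scope.
Local Open Scope ring_scope.

(** The limit has the structure induced from the quotient of the whole cover, so maps on the fibre
    over 0 are obtained by restricting maps that are regular on open pieces of the family. Hence the
    local sections live over A^1 and [Psi] must be regular across u = 0, although the P^1-bundle is
    read off at u = 0 alone. G is not itself a space with functions: regularity of a map into P_a or
    B is tested on the coordinate rings, about which only the axioms are known. The first column of
    the SL_2 part of p is determined only up to a scalar z, so it cannot define the map P_a -> P^1
    directly. The products M_i0 M_j0 alpha(t) are free of this ambiguity because <alpha, coroot> =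
    2. On B the one with i = j = 0 is the character alpha, so the same functions also supply the
    cocycle of the line bundle. *)

Ltac gsimp := rewrite ?(mulgA, invgM, invgK, mulgK, mulgVK, mulgV, mulVg, mulg1,
  mul1g, invg1) //.

(** * Morphisms of spaces with functions *)

Section FSpaceTheory.
Variable K : fieldType.
Implicit Types X Y Z : fspace K.

Lemma reg_ext X (U : set X) f g :
  reg U f -> (forall x, U x -> f x = g x) -> reg U g.
Proof.
move=> rf fg; apply: reg_glue; first exact: reg_open rf.
by move=> x Ux; exists U, f; split=> // y Uy _; rewrite fg.
Qed.

Lemma reg_const X (U : set X) c : open U -> reg U (fun=> c).
Proof. by move=> oU; apply: reg_sub (reg_cst X c) oU _. Qed.

Lemma reg_sum X (U : set X) I (s : seq I) (P : pred I) (f : I -> X -> K) :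
  open U -> (forall i, P i -> reg U (f i)) ->
  reg U (fun x => \sum_(i <- s | P i) f i x).
Proof.
move=> oU rf; elim: s => [|i s IHs].
  by apply: reg_ext (reg_const 0 oU) _ => x _; rewrite big_nil.
case Pi: (P i); last by apply: reg_ext IHs _ => x _; rewrite big_cons Pi.
by apply: reg_ext (reg_add (rf i Pi) IHs) _ => x _; rewrite big_cons Pi.
Qed.

Lemma reg_prod X (U : set X) I (s : seq I) (P : pred I) (f : I -> X -> K) :
  open U -> (forall i, P i -> reg U (f i)) ->
  reg U (fun x => \prod_(i <- s | P i) f i x).
Proof.
move=> oU rf; elim: s => [|i s IHs].
  by apply: reg_ext (reg_const 1 oU) _ => x _; rewrite big_nil.
case Pi: (P i); last by apply: reg_ext IHs _ => x _; rewrite big_cons Pi.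
by apply: reg_ext (reg_mul (rf i Pi) IHs) _ => x _; rewrite big_cons Pi.
Qed.

Lemma reg_exp X (U : set X) f n : reg U f -> reg U (fun x => f x ^+ n).
Proof.
move=> rf; elim: n => [|n IHn]; first exact: reg_const (reg_open rf).
by apply: reg_ext (reg_mul rf IHn) _ => x _; rewrite exprS.
Qed.

Lemma reg_horner X (U : set X) f (p : {poly K}) :
  reg U f -> reg U (fun x => p.[f x]).
Proof.
move=> rf; have oU := reg_open rf.
have := @reg_sum X U _ (index_enum 'I_(size p)) xpredT (fun i x => p`_i * f x ^+ i).
move=> /(_ oU) H; apply: reg_ext; first apply: H.
  by move=> i _; apply: reg_mul; [exact: reg_const|exact: reg_exp].
by move=> x _; rewrite horner_coef.
Qed.

Lemma reg_invN0 X (U : set X) f : reg U f -> (forall x, U x -> f x != 0) ->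
  reg U (fun x => (f x)^-1).
Proof.
move=> rf fN0; apply: reg_sub (reg_inv rf) (reg_open rf) _ => x Ux.
by split=> //; exact: fN0.
Qed.

Lemma reg_expz X (U : set X) f (m : int) : reg U f ->
  (forall x, U x -> f x != 0) -> reg U (fun x => f x ^ m).
Proof.
move=> rf fN0; case: m => n; first exact: reg_exp.
by apply: reg_invN0 (reg_exp n.+1 rf) _ => x Ux; rewrite expf_neq0 ?fN0.
Qed.

Lemma open_neq0 X (U : set X) f : reg U f -> open (U `&` [set x | f x != 0]).
Proof. by move=> rf; exact: reg_open (reg_inv rf). Qed.

Lemma open_local X (A : set X) :
  (forall x, A x -> exists B, [/\ open B, B x & B `<=` A]) -> open A.
Proof.
move=> H; rewrite openE => x /H[B [oB Bx BA]].
by apply: filterS BA _; exact: open_nbhs_nbhs.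
Qed.

Lemma morph_open X Y (A : set X) (f : X -> Y) : morph_on A f -> open A.
Proof. by case=> /(_ _ openT); rewrite preimage_setT setIT. Qed.

Lemma morph_local X Y (A : set X) (f : X -> Y) :
  (forall x, A x -> exists B g,
     [/\ B x, B `<=` A, morph_on B g & forall y, B y -> f y = g y]) ->
  morph_on A f.
Proof.
move=> H.
have oAf V : open V -> open (A `&` f @^-1` V).
  move=> oV; apply: open_local => x [/H[B [g [Bx BA [og _] fg]]] Vx].
  exists (B `&` g @^-1` V); split; first exact: og.
    by split=> //; rewrite /= -fg.
  by move=> y [By Vy]; split; [exact: BA|rewrite /= fg].
split=> // V h rh; apply: reg_glue; first exact/oAf/(reg_open rh).
move=> x [/H[B [g [Bx BA [_ rg] fg]]] Vx].
exists (B `&` g @^-1` V), (h \o g); split; first exact: rg.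
  by split=> //; rewrite /= -fg.
by move=> y [By _] _; rewrite /= fg.
Qed.

Lemma morph_ext X Y (A : set X) (f g : X -> Y) :
  morph_on A f -> (forall x, A x -> f x = g x) -> morph_on A g.
Proof.
move=> mf fg; apply: morph_local => x Ax; exists A, f; split=> // y Ay.
by rewrite fg.
Qed.

Lemma morph_sub X Y (A B : set X) (f : X -> Y) :
  morph_on A f -> open B -> B `<=` A -> morph_on B f.
Proof.
move=> [of_ rf] oB BA.
have E V : B `&` f @^-1` V = B `&` (A `&` f @^-1` V).
  by apply/seteqP; split=> x /= [Bx]; [split=> //; split=> //; exact: BA|case].
split=> [V /of_ oV|V h rh]; first by rewrite E; exact: openI.
apply: reg_sub (rf _ _ rh) _ _; last by move=> x [Bx]; split=> //; exact: BA.
by rewrite E; apply: openI => //; apply: of_; exact: reg_open rh.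
Qed.

Lemma morph_comp X Y Z (A : set X) (B : set Y) (f : X -> Y) (g : Y -> Z) :
  morph_on A f -> morph_on B g -> (forall x, A x -> B (f x)) ->
  morph_on A (g \o f).
Proof.
move=> [of_ rf] [og rg] AB.
have E V : A `&` (g \o f) @^-1` V = A `&` f @^-1` (B `&` g @^-1` V).
  by apply/seteqP; split=> x /= [Ax]; [split=> //; split=> //; exact: AB|case].
by split=> [V oV|V h rh]; rewrite E; [exact/of_/og|exact: rf (rg _ _ rh)].
Qed.

Lemma morph_cst X Y (A : set X) (c : Y) : open A -> morph_on A (fun=> c).
Proof.
move=> oA; have oE (V : set Y) : open (A `&` (fun=> c) @^-1` V).
  apply: open_local => x [Ax Vx]; exists A; split=> // y Ay; split=> //.
by split=> [V _|V h _]; [exact: oE|exact: reg_const].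
Qed.

Lemma reg_comp X Y (A : set X) (V : set Y) (f : X -> Y) h : morph_on A f ->
  reg V h -> (forall x, A x -> V (f x)) -> reg A (h \o f).
Proof.
move=> mf rh AV; apply: reg_sub (mf.2 _ _ rh) (morph_open mf) _ => x Ax.
by split=> //; exact: AV.
Qed.

(** Pulling back along f commutes with every constructor of [gen], and open sets and regular
    functions of an initial structure are locally given by [gen]; so testing the generators is
    enough. *)
Lemma morph_init X T (F : set T -> (T -> K) -> Prop) (A : set X)
    (f : X -> initial_space F) : open A ->
  (forall U h, F U h -> reg (A `&` f @^-1` U) (h \o f)) -> morph_on A f.
Proof.
move=> oA H.
have rg U h : gen F U h -> reg (A `&` f @^-1` U) (h \o f).
  elim=> {U h} [||U V g h _ IHg _ IHh|U V g h _ IHg _ IHh|U g _ IHg].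
  - exact: H.
  - by move=> c; rewrite preimage_setT setIT; exact: reg_const.
  - have oUV : open (A `&` f @^-1` (U `&` V)).
      by rewrite preimage_setI setIIr; apply: openI; [exact: reg_open IHg|
        exact: reg_open IHh].
    by apply: reg_add; [apply: reg_sub IHg oUV _|apply: reg_sub IHh oUV _]
      => x [Ax []].
  - have oUV : open (A `&` f @^-1` (U `&` V)).
      by rewrite preimage_setI setIIr; apply: openI; [exact: reg_open IHg|
        exact: reg_open IHh].
    by apply: reg_mul; [apply: reg_sub IHg oUV _|apply: reg_sub IHh oUV _]
      => x [Ax []].
  - by have := reg_inv IHg; rewrite -setIA.
have oAf V : open V -> open (A `&` f @^-1` V).
  move=> oV; apply: open_local => x [Ax /oV[U [g [gg Ux UV]]]].
  exists (A `&` f @^-1` U); split; [exact: reg_open (rg _ _ gg)|by []|].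
  by apply: setIS => y; exact: UV.
split=> // V h [oV Hh]; apply: reg_glue; first exact: oAf.
move=> x [Ax /Hh[U [g [gg Ux UV hg]]]].
exists (A `&` f @^-1` U), (g \o f); split=> //; first exact: rg.
by move=> y [_ Uy] _; exact: hg.
Qed.

Lemma gen_reg T (F : set T -> (T -> K) -> Prop) U f :
  F U f -> @reg K (initial_space F) U f.
Proof.
move=> FUf; have gf := gen_base FUf; split; first exact: gen_open gf.
by move=> x Ux; exists U, f; split=> // y.
Qed.

Lemma morph_affine X T (Fs : set (T -> K)) (A : set X)
    (f : X -> affine_space Fs) : open A ->
  (forall h, Fs h -> reg A (h \o f)) -> morph_on A f.
Proof.
move=> oA H; apply: morph_init => // U h [-> Fh].
by rewrite preimage_setT setIT; exact: H.
Qed.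

Lemma reg_affine T (Fs : set (T -> K)) h : Fs h -> @reg K (affine_space Fs) setT h.
Proof. by move=> Fh; exact: gen_reg. Qed.

Lemma morph_sval X (A : set X) : @morph_on K (subspace_of A) X setT sval.
Proof.
have rs V g : reg V g -> @reg K (subspace_of A) (sval @^-1` V) (g \o sval).
  by move=> rg; apply: gen_reg; exists V, g.
split=> [V oV|V h rh]; rewrite setTI; last exact: rs.
exact: reg_open (rs _ _ (reg_const 0 oV)).
Qed.

Lemma morph_subspace X Z (A : set X) (B : set Z) (f : Z -> subspace_of A) :
  @morph_on K Z X B (fun z => sval (f z)) -> morph_on B f.
Proof.
move=> mf; apply: morph_init; first exact: morph_open mf.
by move=> _ _ [V [g [rg -> ->]]]; exact: mf.2 rg.
Qed.

Lemma morph_fst X Y : @morph_on K (prod_space X Y) X setT fst.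
Proof.
have rs V g : reg V g -> @reg K (prod_space X Y) (fst @^-1` V) (g \o fst).
  by move=> rg; apply: gen_reg; left; exists V, g.
split=> [V oV|V h rh]; rewrite setTI; last exact: rs.
exact: reg_open (rs _ _ (reg_const 0 oV)).
Qed.

Lemma morph_snd X Y : @morph_on K (prod_space X Y) Y setT snd.
Proof.
have rs V g : reg V g -> @reg K (prod_space X Y) (snd @^-1` V) (g \o snd).
  by move=> rg; apply: gen_reg; right; exists V, g.
split=> [V oV|V h rh]; rewrite setTI; last exact: rs.
exact: reg_open (rs _ _ (reg_const 0 oV)).
Qed.

Lemma morph_pair X Y Z (A : set Z) (f : Z -> X) (g : Z -> Y) :
  morph_on A f -> morph_on A g ->
  @morph_on K Z (prod_space X Y) A (fun z => (f z, g z)).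
Proof.
move=> mf mg; apply: morph_init; first exact: morph_open mf.
by move=> _ _ [] [V [h [rh -> ->]]]; [exact: mf.2 rh|exact: mg.2 rh].
Qed.

Lemma morph_qproj X (R : X -> set X) : @morph_on K X (quot_space R) setT (qproj R).
Proof. by split=> [V oV|V h rh]; rewrite setTI; [exact: oV|exact: rh]. Qed.

Lemma morph_quot X Z (R : X -> set X) (A : set (quot_space R))
    (f : quot_space R -> Z) :
  morph_on (qproj R @^-1` A) (f \o qproj R) -> morph_on A f.
Proof. by move=> [of_ rf]; split=> [V /of_|V h /rf]. Qed.

Lemma qproj_surj X (R : X -> set X) (y : quot_space R) : exists x, qproj R x = y.
Proof.
by case: y => A [x Ax]; exists x; apply: eq_exist; rewrite Ax.
Qed.

(** A representative picked by choice, without any regularity. A map on a quotient defined through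
    it becomes a morphism once its independence of the representative is shown and [morph_quot]
    moves the question upstairs. *)
Definition qrep X (R : X -> set X) (y : quot_space R) : X := sval (cid (qproj_surj y)).

Lemma qrepK X (R : X -> set X) (y : quot_space R) : qproj R (qrep y) = y.
Proof. exact: svalP (cid (qproj_surj y)). Qed.

Lemma qprojP X (R : X -> set X) x y : (forall x, R x x) ->
  (forall x y, R x y -> R y x) -> (forall x y z, R x y -> R y z -> R x z) ->
  qproj R x = qproj R y <-> R x y.
Proof.
move=> Rxx Rs Rt; split=> [[->//]|Rxy].
apply: eq_exist; apply/seteqP; split=> z /= Rz; last exact: Rt Rxy Rz.
exact: Rt (Rs _ _ Rxy) Rz.
Qed.

End FSpaceTheory.

(** * The Levi decomposition of P_a *)

Section TwoByTwoMatrices.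
Variable K : fieldType.
Implicit Types (M N : 'M[K]_2) (a b c d x y z : K).

Lemma mx22E M : M = mx22 (M 0 0) (M 0 1) (M 1 0) (M 1 1).
Proof.
by apply/matrixP=> i j; rewrite mxE; case: i => [[|[|i]] hi] //;
  case: j => [[|[|j]] hj] //=; congr (M _ _); apply: val_inj.
Qed.

Lemma mx22_inj a b c d a' b' c' d' : a = a' -> b = b' -> c = c' -> d = d' ->
  mx22 a b c d = mx22 a' b' c' d'.
Proof. by move=> -> -> -> ->. Qed.

Lemma det_mx22 a b c d : \det (mx22 a b c d) = a * d - b * c.
Proof.
rewrite (expand_det_row _ 0) !big_ord_recl big_ord0 /cofactor !det_mx11 !mxE /=.
by rewrite addr0 expr0 expr1 mul1r mulN1r mulrN.
Qed.

Lemma mul_mx22 a b c d a' b' c' d' : mx22 a b c d *m mx22 a' b' c' d' =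
  mx22 (a * a' + b * c') (a * b' + b * d') (c * a' + d * c') (c * b' + d * d').
Proof.
by apply/matrixP=> i j; rewrite !mxE !big_ord_recl big_ord0 !mxE /= addr0;
  case: i => [[|[|i]] hi] //; case: j => [[|[|j]] hj].
Qed.

Lemma mx22_1 : 1%:M = mx22 1 0 0 1 :> 'M[K]_2.
Proof.
by apply/matrixP=> i j; rewrite !mxE; case: i => [[|[|i]] hi] //;
  case: j => [[|[|j]] hj].
Qed.

Lemma detE2 M : \det M = M 0 0 * M 1 1 - M 0 1 * M 1 0.
Proof. by rewrite {1}[M]mx22E det_mx22. Qed.

Lemma det_upper c : \det (upper c) = 1.
Proof. by rewrite det_mx22; ring. Qed.

Lemma det_lower c : \det (lower c) = 1.
Proof. by rewrite det_mx22; ring. Qed.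

Lemma det_diag2 z : z != 0 -> \det (diag2 z) = 1.
Proof. by move=> z0; rewrite det_mx22 mulfV // mulr0 subr0. Qed.

Lemma det_mulmx1 M N : \det M = 1 -> \det N = 1 -> \det (M *m N) = 1.
Proof. by rewrite det_mulmx => -> ->; rewrite mulr1. Qed.

(** Conjugation by diag(x, 1) in GL_2. This is how T acts on SL_2 with x = alpha(t), and it requires
    no square root of x. *)
Definition conj2 x M := mx22 (M 0 0) (x * M 0 1) (x^-1 * M 1 0) (M 1 1).

Lemma conj2M x M N : x != 0 -> conj2 x (M *m N) = conj2 x M *m conj2 x N.
Proof.
move=> x0; rewrite [M]mx22E [N]mx22E mul_mx22 /conj2 !mxE /= mul_mx22.
by apply: mx22_inj; field.
Qed.

Lemma det_conj2 x M : x != 0 -> \det (conj2 x M) = \det M.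
Proof. by move=> x0; rewrite det_mx22 detE2; field. Qed.

(** Elementary matrices generate SL_2. If c != 0 the matrix is upper times lower times upper; if c =
    0 then d != 0, and splitting off [lower (-1)] on the right turns the lower left entry into c + d
    = d. *)
Lemma sl2_ind (P : 'M[K]_2 -> Prop) :
  (forall c, P (upper c)) -> (forall c, P (lower c)) ->
  (forall M N, \det M = 1 -> \det N = 1 -> P M -> P N -> P (M *m N)) ->
  forall M, \det M = 1 -> P M.
Proof.
move=> Pu Pl PM.
have P0 a b c d : c != 0 -> a * d - b * c = 1 -> P (mx22 a b c d).
  move=> c0 D1.
  have -> : mx22 a b c d = upper ((a - 1) / c) *m lower c *m upper ((d - 1) / c).
    rewrite !mul_mx22; apply: mx22_inj; try by field.
    have -> : b = (a * d - 1) / c by rewrite -D1; field.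
    by field.
  by apply: (PM); rewrite ?det_mulmx1 ?det_upper ?det_lower //; apply: (PM);
    rewrite ?det_upper ?det_lower.
move=> M; rewrite [M]mx22E det_mx22.
move: (M 0 0) (M 0 1) (M 1 0) (M 1 1) => a b c d D1.
have [c0|c0] := eqVneq c 0; last exact: P0.
have d0 : d != 0.
  by apply: contra_eq_neq D1 => ->; rewrite c0 !mulr0 subr0 eq_sym oner_eq0.
have -> : mx22 a b c d = mx22 (a + b) b (c + d) d *m lower (-1).
  by rewrite mul_mx22; apply: mx22_inj; ring.
have D2 : (a + b) * d - b * (c + d) = 1 by rewrite -D1; ring.
apply: (PM); rewrite ?det_lower ?det_mx22 //.
by apply: P0 => //; rewrite c0 add0r.
Qed.

End TwoByTwoMatrices.

Section Characters.
Variables (K : fieldType) (n : nat).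
Implicit Types (s t : 'I_n -> K) (m c : 'rV[int]_n).

Lemma characterM m s t :
  character m (fun k => s k * t k) = character m s * character m t.
Proof. by rewrite -big_split; apply: eq_bigr => k _; rewrite expfzMl. Qed.

Lemma character_neq0 m t : torus t -> character m t != 0.
Proof. by move=> tT; apply/prodf_neq0 => k _; rewrite expfz_neq0 ?tT. Qed.

Lemma characterV m t : character m (fun k => (t k)^-1) = (character m t)^-1.
Proof.
rewrite /character -prodfV; apply: eq_bigr => k _.
by rewrite exprz_inv invr_expz.
Qed.

Lemma character1 m : character m (fun=> 1 : K) = 1.
Proof. by rewrite /character big1 // => k _; rewrite exp1rz. Qed.

Lemma character_cochar m c (z : K) : z != 0 ->
  character m (cochar c z) = z ^ (\sum_k m 0 k * c 0 k).
Proof.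
move=> z0; rewrite /character.
elim/big_rec2: _ => [|k y x _ ->]; first by rewrite expr0z.
by rewrite expfzDr // /cochar exprz_exp [m _ _ * _]mulrC.
Qed.

Lemma torus_cochar c (z : K) : z != 0 -> torus (cochar c z).
Proof. by move=> z0 k; rewrite expfz_neq0. Qed.

Lemma torusM s t : torus s -> torus t -> torus (fun k => s k * t k).
Proof. by move=> sT tT k; rewrite mulf_neq0 ?sT ?tT. Qed.

Lemma torusV t : torus t -> torus (fun k => (t k)^-1).
Proof. by move=> tT k; rewrite invr_eq0 tT. Qed.

Lemma torus1 : @torus K n (fun=> 1).
Proof. by move=> k; exact: oner_neq0. Qed.

End Characters.

Section KacMoodyGroup.
Variables (K : fieldType) (D : root_datum) (G : km_group K D).
Implicit Types (a : simple D) (s t : 'I_(rdim D) -> K) (p g u v : G)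
  (M N : 'M[K]_2).
Local Notation alpha a := (character (@simple_root D a)).
Local Notation ax := (km_axiomsP G).
Local Notation rad := Defs.rad.
Local Notation coord := Defs.coord.
Local Open Scope group_scope.

Lemma subgroupV (H : set G) g : is_subgroup H -> H g -> H g^-1.
Proof. by case=> H1 HV Hg; rewrite -[g^-1]mul1g; exact: HV. Qed.

Lemma subgroupM (H : set G) g h : is_subgroup H -> H g -> H h -> H (g * h).
Proof.
by move=> sH Hg Hh; rewrite -[h]invgK; apply: sH.2 => //; exact: subgroupV.
Qed.

Lemma tor1 : tor G (fun=> 1%R) = 1.
Proof.
have T1 : torus (fun=> 1%R) := @torus1 K (rdim D).
have /= := torM ax T1 T1.
have -> : (fun=> 1 * 1)%R = (fun=> 1%R) :> ('I_(rdim D) -> K).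
  by apply/funext=> k; rewrite mulr1.
by move=> /(congr1 (fun g => g * (tor G (fun=> 1%R))^-1)); gsimp.
Qed.

Lemma torV t : torus t -> tor G (fun k => (t k)^-1)%R = (tor G t)^-1.
Proof.
move=> tT; apply: (mulgI (tor G t)).
rewrite -(torM ax) //; last exact: torusV.
rewrite mulgV -tor1; congr (tor G _); apply/funext=> k.
by rewrite mulfV ?tT.
Qed.

Lemma tor_comm s t : torus s -> torus t -> tor G s * tor G t = tor G t * tor G s.
Proof.
move=> sT tT; rewrite -!(torM ax) //; congr (tor G _); apply/funext=> k.
by rewrite mulrC.
Qed.

Lemma maxtorus_tor t : torus t -> maxtorus G (tor G t).
Proof. by move=> tT; exists t. Qed.

Lemma maxtorus_group : is_subgroup (maxtorus G).
Proof.
split; first by rewrite -tor1; apply: maxtorus_tor; exact: torus1.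
move=> _ _ [s sT <-] [t tT <-]; rewrite -torV // -(torM ax) //; last exact: torusV.
by apply: maxtorus_tor; apply: torusM => //; exact: torusV.
Qed.

Lemma sl2_1 a : sl2 G a 1%:M = 1.
Proof.
have /= := sl2M ax a (det1 K 2) (det1 K 2); rewrite mulmx1.
by move=> /(congr1 (fun g => g * (sl2 G a 1%:M)^-1)); gsimp.
Qed.

Lemma rad_group a : is_subgroup (rad G a).
Proof.
have [U1 UM] := unip_group ax; split; first by split; gsimp.
move=> u v [Uu Su] [Uv Sv]; split; first exact: UM.
by have := UM _ _ Su Sv; gsimp.
Qed.

Lemma unip_rad a u : rad G a u -> unip G u. Proof. by case. Qed.

Lemma borelP b : borel G b <-> exists t u, [/\ torus t, unip G u & b = tor G t * u].
Proof.
split=> [[_ [t tT <-] [u Uu <-]]|[t [u [tT Uu ->]]]]; first by exists t, u.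
by exists (tor G t); [exact: maxtorus_tor|exists u].
Qed.

Lemma borel_mk t u : torus t -> unip G u -> borel G (tor G t * u).
Proof. by move=> tT Uu; apply/borelP; exists t, u. Qed.

Lemma borel_unip u : unip G u -> borel G u.
Proof. by move=> Uu; rewrite -[u]mul1g -tor1; apply: borel_mk => //; exact: torus1. Qed.

Lemma borel_maxtor t : torus t -> borel G (tor G t).
Proof.
by move=> tT; rewrite -[tor G t]mulg1; apply: borel_mk => //; case: (unip_group ax).
Qed.

Lemma unip_conj t u : torus t -> unip G u -> unip G (tor G t * u * (tor G t)^-1).
Proof. by move=> tT; apply: (unip_norm ax); exact: maxtorus_tor. Qed.

Lemma unip_conjV t u : torus t -> unip G u -> unip G ((tor G t)^-1 * u * tor G t).
Proof. by move=> tT /(unip_conj (torusV tT)); rewrite torV // invgK. Qed.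

Lemma tor_unipM s t u v :
  torus s -> torus t -> tor G s * u * (tor G t * v) =
  tor G (fun k => s k * t k)%R * ((tor G t)^-1 * u * tor G t * v).
Proof. by move=> sT tT; rewrite (torM ax) //; gsimp. Qed.

Lemma borel_group : is_subgroup (borel G).
Proof.
have gU := unip_group ax.
split; first by apply: borel_unip; case: gU.
move=> _ _ /borelP[s [u [sT Uu ->]]] /borelP[t [v [tT Uv ->]]].
have -> : tor G s * u * (tor G t * v)^-1 =
    tor G (fun k => s k * (t k)^-1)%R * (tor G t * (u * v^-1) * (tor G t)^-1).
  by rewrite (torM ax) // ?torV //; [gsimp|exact: torusV].
apply: borel_mk; first by apply: torusM => //; exact: torusV.
by apply: unip_conj => //; exact: gU.2.
Qed.

(** Since [borel_tor] is a choice, uniqueness is needed: the quotient of two candidates lies in T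
    and, as T normalizes U, also in U, so [unip_tor] applies. *)
Lemma borel_torE t u : torus t -> unip G u -> borel_tor (tor G t * u) = tor G t.
Proof.
move=> tT Uu; rewrite /borel_tor; case: xgetP => [g _ [Tg Ug]|/(_ (tor G t))] /=.
  apply: divg1_eq.
  have gT := maxtorus_group; have gU := unip_group ax.
  apply: (unip_tor ax); first by apply: gT.2 => //; exact: maxtorus_tor.
  have -> : g / tor G t = tor G t * ((g^-1 * (tor G t * u)) * u^-1)^-1 * (tor G t)^-1.
    by gsimp.
  by apply: unip_conj => //; apply: subgroupV => //; exact: gU.2.
by case; split; [exact: maxtorus_tor|gsimp].
Qed.

Lemma borel_torM b c : borel G b -> borel G c ->
  borel_tor (b * c) = borel_tor b * borel_tor c.
Proof.
move=> /borelP[s [u [sT Uu ->]]] /borelP[t [v [tT Uv ->]]].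
rewrite tor_unipM // !borel_torE //; first exact: (torM ax).
  exact: torusM.
by apply: subgroupM (unip_group ax) _ Uv; exact: unip_conjV.
Qed.

(** * The endomorphisms Psi_z of B *)

Section Degeneration.
Variable lambda : 'rV[int]_(rdim D).
Local Notation Psi := (@Psi K D G lambda).

Lemma Psi0 b : Psi 0%R b = borel_tor b.
Proof. by rewrite /Psi eqxx. Qed.

Lemma PsiE z b : z != 0%R ->
  Psi z b = tor G (cochar lambda z) * b * (tor G (cochar lambda z))^-1.
Proof. by rewrite /Psi => /negPf ->. Qed.

Lemma Psi_borel z b : borel G b -> borel G (Psi z b).
Proof.
move=> Bb; have [->|z0] := eqVneq z 0%R.
  have /borelP[t [v [tT Uv ->]]] := Bb.
  by rewrite Psi0 borel_torE //; exact: borel_maxtor.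
rewrite PsiE //; apply: borel_group.2; last exact/borel_maxtor/torus_cochar.
by apply: subgroupM borel_group _ Bb; exact/borel_maxtor/torus_cochar.
Qed.

Lemma PsiM z b c : borel G b -> borel G c -> Psi z (b * c) = Psi z b * Psi z c.
Proof.
move=> Bb Bc; have [->|z0] := eqVneq z 0%R; first by rewrite !Psi0 borel_torM.
by rewrite !PsiE //; gsimp.
Qed.

Lemma Psi1 z : Psi z 1 = 1.
Proof.
apply: (mulgI (Psi z 1)); rewrite -PsiM ?mulg1 //; exact: borel_group.1.
Qed.

End Degeneration.

Lemma borel_minpar a b : borel G b -> minpar G a b. Proof. by left. Qed.

(** The axioms describe the action of T on root subgroups only; [conj2] is multiplicative, so
    generation of SL_2 by these subgroups extends it. *)
Lemma sl2_tor_conj a t M : torus t -> \det M = 1%R ->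
  tor G t * sl2 G a M * (tor G t)^-1 = sl2 G a (conj2 (alpha a t) M).
Proof.
move=> tT; have x0 := character_neq0 (simple_root a) tT.
elim/sl2_ind => [c|c|{}M N dM dN IM IN].
- rewrite (tor_upper ax) //; congr (sl2 G a _).
  by rewrite /conj2 /upper !mxE /= mulr0.
- rewrite (tor_lower ax) //; congr (sl2 G a _).
  by rewrite /conj2 /lower !mxE /= mulr0.
rewrite conj2M // !(sl2M ax) ?det_conj2 // -IM -IN.
by gsimp.
Qed.

(** Coordinates of p in SL_2 x T x U_a. They are not unique, because SL_2 x T maps to L_a with a
    kernel. *)
Definition decomp a p M t u :=
  [/\ \det M = 1%R, torus t, rad G a u & p = sl2 G a M * tor G t * u].

Lemma minpar_decomp a p : minpar G a p -> exists M t u, decomp a p M t u.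
Proof.
rewrite (minpar_levi ax) => -[_ [_ [M dM <-] [_ [t tT <-] <-]] [u Ru <-]].
by exists M, t, u.
Qed.

Lemma decomp_minpar a p M t u : decomp a p M t u -> minpar G a p.
Proof.
move=> [dM tT Ru ->]; rewrite (minpar_levi ax); exists (sl2 G a M * tor G t).
  by exists (sl2 G a M); [exists M|exists (tor G t); first exists t].
by exists u.
Qed.

Lemma sl2_minpar a M : \det M = 1%R -> minpar G a (sl2 G a M).
Proof.
move=> dM; apply: (@decomp_minpar _ _ M (fun=> 1%R) 1); split=> //.
- exact: torus1.
- by case: (rad_group a).
- by rewrite tor1; gsimp.
Qed.

Lemma det_adj2 M : \det M = 1%R -> \det (\adj M) = 1%R.
Proof.
move=> dM; have := congr1 (fun N : 'M[K]_2 => \det N) (mul_mx_adj M).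
by rewrite det_mulmx dM mul1r det1.
Qed.

Lemma sl2V a M : \det M = 1%R -> (sl2 G a M)^-1 = sl2 G a (\adj M).
Proof.
move=> dM; apply: mulg1_eq; rewrite -(sl2M ax) // ?det_adj2 //.
by rewrite mul_mx_adj dM sl2_1.
Qed.

(** Separating the factors puts N^-1 M t s^-1 into both L_a and U_a, which meet trivially by
    [levi_rad]. So the image of N^-1 M lies in T, and [sl2_tor] makes N^-1 M diagonal. *)
Lemma decomp_uniq a p M t u N s v : decomp a p M t u -> decomp a p N s v ->
  exists2 z, z != 0%R & M = (N *m diag2 z)%R /\
    s = (fun k => cochar (simple_coroot a) z k * t k)%R.
Proof.
move=> [dM tT Ru ->] [dN sT Rv E].
have x0 := character_neq0 (simple_root a) tT.
pose N' := \adj N; have dN' : \det N' = 1%R by exact: det_adj2.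
have dL : \det (N' *m M)%R = 1%R by exact: det_mulmx1.
have {}E : sl2 G a (N' *m M)%R * tor G t * (tor G s)^-1 =
    tor G s * (v * u^-1) * (tor G s)^-1.
  rewrite (sl2M ax) // -sl2V //.
  have := congr1 (fun g => (sl2 G a N)^-1 * g * u^-1 * (tor G s)^-1) E.
  by gsimp.
have lev : levi G a (sl2 G a (N' *m M)%R * tor G t * (tor G s)^-1).
  exists (sl2 G a (N' *m M)%R); first by exists (N' *m M)%R.
  exists (tor G t * (tor G s)^-1); last by rewrite mulgA.
  by apply: maxtorus_group.2; exact: maxtorus_tor.
have l1 : sl2 G a (N' *m M)%R * tor G t * (tor G s)^-1 = 1.
  apply: (levi_rad ax) lev _; rewrite E; apply: (rad_norm ax).
    by apply: borel_minpar; exact: borel_maxtor.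
  exact: (rad_group a).2.
have l2 : sl2 G a (N' *m M)%R = tor G s * (tor G t)^-1.
  by have := congr1 (fun g => g * tor G s * (tor G t)^-1) l1; gsimp.
have /is_diag_mxP dg : is_diag_mx (N' *m M)%R.
  apply: (sl2_tor ax) (a) _ dL _; rewrite l2.
  by apply: maxtorus_group.2; exact: maxtorus_tor.
set L := (N' *m M)%R in dL l2 dg.
have e01 : L 0%R 1%R = 0%R by apply: dg.
have e10 : L 1%R 0%R = 0%R by apply: dg.
have dL' : (L 0%R 0%R * L 1%R 1%R = 1)%R.
  by move: dL; rewrite detE2 e01 mul0r subr0.
have z0 : L 0%R 0%R != 0%R.
  by apply: contra_eq_neq dL' => ->; rewrite mul0r eq_sym oner_eq0.
have eL : L = diag2 (L 0%R 0%R).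
  rewrite {1}[L]mx22E e01 e10 /diag2; apply: mx22_inj => //.
  by rewrite -[RHS]mulr1 -dL' mulKf.
exists (L 0%R 0%R) => //; split.
  by rewrite -eL /L /N' mulmxA mul_mx_adj dN mul1mx.
apply: (tor_inj ax) => //.
  by apply: torusM => //; exact: torus_cochar.
rewrite (torM ax) //; last exact: torus_cochar.
by rewrite -(sl2_diag ax) // -eL l2; gsimp.
Qed.

Lemma alpha_coroot a (z : K) : z != 0%R ->
  alpha a (cochar (simple_coroot a) z) = (z ^+ 2)%R.
Proof.
move=> z0; rewrite character_cochar // -cartanE.
by case: (@cartanP D) => ->.
Qed.

(* The functions M_i0 M_j0 alpha(t) on P_a: unlike the entries M_i0 themselves,
   they are well defined on L_a = SL_2 x T / {(diag z, coroot(z)^-1)}. *)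
Definition quad a i j p : K :=
  xget 0%R [set c | exists M t u, decomp a p M t u /\
                      c = M i 0 * M j 0 * alpha a t]%R.

(** Passing to another decomposition scales each of the two entries by z, and alpha(coroot(z)) = z^2
    compensates. *)
Lemma quadE a i j p M t u : decomp a p M t u ->
  quad a i j p = (M i 0 * M j 0 * alpha a t)%R.
Proof.
move=> dp; rewrite /quad.
case: xgetP => [c _ [N [s [v [dq ->]]]]|/(_ (M i 0 * M j 0 * alpha a t)%R)] /=.
  have [z z0 [-> ->]] := decomp_uniq dp dq.
  rewrite characterM alpha_coroot // [in RHS](mx22E N).
  rewrite /diag2 mul_mx22 !mulr0 !addr0.
  have E k : (mx22 (N 0 0 * z) (N 0 1 * z^-1) (N 1 0 * z) (N 1 1 * z^-1) k 0 =
      N k 0 * z)%R.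
    rewrite mxE; case: k => [[|[|k]] hk] //=; congr (N _ _ * _)%R; exact: val_inj.
  rewrite !add0r !E; ring.
by case; exists M, t, u.
Qed.

Lemma decomp_mulr a p M t u v : decomp a p M t u -> rad G a v ->
  decomp a (p * v) M t (u * v).
Proof.
move=> [dM tT Ru ->] Rv; split=> //; last by gsimp.
exact: subgroupM (rad_group a) Ru Rv.
Qed.

(** U_a is normal in P_a, so u moves to the right past the factors from T and SL_2; moving t s past
    [upper c] rescales c. The matrix M gets an upper unitriangular right factor, which keeps its
    first column and hence the point of P^1. *)
Lemma decomp_mul_borel a p M t u s c v : decomp a p M t u -> torus s ->
  rad G a v -> exists w, decomp a (p * (tor G s * (sl2 G a (upper c) * v)))
    (M *m upper (alpha a t * alpha a s * c))%R (fun k => t k * s k)%R w.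
Proof.
move=> [dM tT Ru ->] sT Rv; pose g := tor G s * sl2 G a (upper c).
have Pg : minpar G a g.
  apply: subgroupM (minpar_group ax a) _ (sl2_minpar _ (det_upper c)).
  by apply: borel_minpar; exact: borel_maxtor.
have tsT := torusM tT sT.
exists (g^-1 * u * g * v); split.
- by rewrite det_mulmx1 // det_upper.
- exact: torusM.
- apply: subgroupM (rad_group a) _ Rv.
  rewrite -{2}[g]invgK; apply: (rad_norm ax) => //.
  exact: subgroupV (minpar_group ax a) Pg.
- rewrite (sl2M ax) ?det_upper // -characterM -(tor_upper ax) // /g.
  by rewrite (torM ax) //; gsimp.
Qed.

Lemma decomp_tor a p M t u s : decomp a p M t u -> torus s ->
  decomp a (tor G s * p) (conj2 (alpha a s) M) (fun k => s k * t k)%R u.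
Proof.
move=> [dM tT Ru ->] sT; have x0 := character_neq0 (simple_root a) sT.
split=> //; first by rewrite det_conj2.
  exact: torusM.
by rewrite -sl2_tor_conj // (torM ax) //; gsimp.
Qed.

Lemma borel_decomp a b : borel G b ->
  exists s c v, [/\ torus s, rad G a v & b = tor G s * (sl2 G a (upper c) * v)].
Proof.
move=> /borelP[s [u [sT]]]; rewrite (unip_root ax a) => -[c _ [v Rv <-]] ->.
by exists s, c, v.
Qed.

Lemma reg_sl2 (i j : 'I_2) :
  @reg K (sl2_torus K (rdim D)) setT (fun x => (sval x).1 i j).
Proof. by apply: reg_affine; left; exists i, j. Qed.

Lemma reg_torus k : @reg K (sl2_torus K (rdim D)) setT (fun x => (sval x).2 k).
Proof. by apply: reg_affine; right; exists k. Qed.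

Lemma reg_character m :
  @reg K (sl2_torus K (rdim D)) setT (fun x => character m (sval x).2).
Proof.
apply: reg_prod => [|k _]; first exact: openT.
apply: reg_expz (reg_torus k) _ => x _; exact: (svalP x).2.
Qed.

(** [coord_proj] applies: right translation by U_a does not change M and t, and on SL_2 x T the
    function is a product of matrix entries and a character. *)
Lemma coord_quad a i j : coord G a (quad a i j).
Proof.
apply: (coord_proj ax) => [p u Pp Ru|].
  have [M [t [v dp]]] := minpar_decomp Pp.
  by rewrite (quadE _ _ dp) (quadE _ _ (decomp_mulr dp Ru)).
apply: reg_ext (reg_mul (reg_mul (reg_sl2 i 0) (reg_sl2 j 0))
  (reg_character (simple_root a))) _.
move=> [[M t] [/= dM tT]] _; rewrite /levi_pull /= (@quadE _ _ _ _ M t 1) //.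
by split=> //; [case: (rad_group a)|gsimp].
Qed.

End KacMoodyGroup.

(** * The projective line *)

Section ProjectiveLine.
Variable K : fieldType.
Implicit Types (x y : K) (l : P1 K) (e : bool).

Definition nonzero2 x y := (x != 0) || (y != 0).

Lemma one_zero_neq : (1, 0) <> (0, 0) :> K * K.
Proof. by case=> /eqP; rewrite oner_eq0. Qed.

(** Made total by the default point (1, 0), so that [line] can be applied to arbitrary functions and
    non-vanishing is checked only where it matters. *)
Definition ppoint x y : punctured_plane K :=
  if pselect ((x, y) <> (0, 0)) is left h then exist _ (x, y) h
  else exist _ (1, 0) one_zero_neq.

Definition line x y : P1 K := qproj (@collinear K) (ppoint x y).

Lemma ppointE x y : nonzero2 x y -> sval (ppoint x y) = (x, y).
Proof.
rewrite /ppoint; case: pselect => //= /contrapT[-> ->].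
by rewrite /nonzero2 eqxx.
Qed.

Lemma ppoint_sval (v : punctured_plane K) : ppoint (sval v).1 (sval v).2 = v.
Proof.
rewrite /ppoint; case: v => [[x y] h] /=; case: pselect => // h'.
by congr exist; exact: Prop_irrelevance.
Qed.

Lemma nonzero2_sval (v : punctured_plane K) : nonzero2 (sval v).1 (sval v).2.
Proof.
case: v => [[x y] h] /=; rewrite /nonzero2 -negb_and; apply/negP.
by move=> /andP[/eqP xy0 /eqP y0]; apply: h; rewrite xy0 y0.
Qed.

Lemma collinear_equiv (v w : punctured_plane K) :
  qproj (@collinear K) v = qproj (@collinear K) w <-> collinear v w.
Proof.
apply: qprojP => {v w} [v|v w [c c0 E]|u v w [c c0 Ec] [d d0 Ed]].
- by exists 1; [exact: oner_neq0|rewrite !mul1r -surjective_pairing].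
- exists c^-1; first by rewrite invr_eq0.
  by rewrite E /= !mulKf // -surjective_pairing.
by exists (d * c); [rewrite mulf_neq0|rewrite Ed Ec /= !mulrA].
Qed.

Lemma line_eq x y x' y' : nonzero2 x y -> nonzero2 x' y' ->
  x * y' = x' * y -> line x y = line x' y'.
Proof.
move=> h h' E; apply/collinear_equiv; rewrite /collinear /= !ppointE //=.
have [x0|x0] := eqVneq x 0.
  have y0 : y != 0 by move: h; rewrite /nonzero2 x0 eqxx.
  have x'0 : x' = 0.
    by move/eqP: E; rewrite x0 mul0r eq_sym mulf_eq0 (negPf y0) orbF => /eqP.
  have y'0 : y' != 0 by move: h'; rewrite /nonzero2 x'0 eqxx.
  exists (y' / y); first by rewrite mulf_neq0 ?invr_eq0.
  by rewrite x0 x'0 mulr0 divfK.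
exists (x' / x); last by rewrite divfK // mulrAC -E mulrC mulKf.
rewrite mulf_neq0 ?invr_eq0 //; apply/eqP => x'0.
move: h'; rewrite /nonzero2 x'0 eqxx /= => y'0; move/eqP: E.
by rewrite x'0 mul0r mulf_eq0 (negPf x0) (negPf y'0).
Qed.

Lemma line_inj x y x' y' : nonzero2 x y -> nonzero2 x' y' ->
  line x y = line x' y' -> x * y' = x' * y.
Proof.
move=> h h' /collinear_equiv[c c0]; rewrite !ppointE //= => -[-> ->].
by rewrite mulrCA mulrA.
Qed.

Lemma line_surj l : exists x y, nonzero2 x y /\ l = line x y.
Proof.
have [v <-] := qproj_surj l; exists (sval v).1, (sval v).2.
by split; [exact: nonzero2_sval|rewrite /line ppoint_sval].
Qed.

Definition prep l : punctured_plane K := qrep l.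

Definition lcoord e (v : K * K) := if e then v.2 else v.1.
(* The inhomogeneous coordinates y/x (on x != 0) and x/y (on y != 0). *)
Definition chart e : set (P1 K) := [set l | lcoord e (sval (prep l)) != 0].
Definition slope e l : K :=
  lcoord (~~ e) (sval (prep l)) / lcoord e (sval (prep l)).

Lemma qrep_proj (v : punctured_plane K) : exists2 c, c != 0 &
  sval (prep (qproj (@collinear K) v)) = (c * (sval v).1, c * (sval v).2).
Proof. by apply/collinear_equiv; rewrite /prep qrepK. Qed.

Lemma lcoordZ e c (v : K * K) : lcoord e (c * v.1, c * v.2) = c * lcoord e v.
Proof. by case: e. Qed.

Lemma chart_proj e v : chart e (qproj (@collinear K) v) <-> lcoord e (sval v) != 0.
Proof.
rewrite /chart /=; have [c c0 ->] := qrep_proj v.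
by rewrite lcoordZ mulf_eq0 (negPf c0).
Qed.

Lemma slope_proj e v : slope e (qproj (@collinear K) v) =
  lcoord (~~ e) (sval v) / lcoord e (sval v).
Proof.
rewrite /slope; have [c c0 ->] := qrep_proj v.
by rewrite !lcoordZ -mulf_div divff // mul1r.
Qed.

Lemma chart_line e x y : nonzero2 x y -> chart e (line x y) <-> lcoord e (x, y) != 0.
Proof. by move=> h; rewrite chart_proj ppointE. Qed.

Lemma slope_line e x y : nonzero2 x y ->
  slope e (line x y) = lcoord (~~ e) (x, y) / lcoord e (x, y).
Proof. by move=> h; rewrite slope_proj ppointE. Qed.

Lemma chart_cover l : chart false l \/ chart true l.
Proof.
have [x [y [h ->]]] := line_surj l; rewrite !chart_line //=.
by case/orP: h; [left|right].
Qed.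

Lemma reg_lcoord e : @reg K (punctured_plane K) setT (fun v => lcoord e (sval v)).
Proof. by apply: reg_affine; case: e; [right|left]. Qed.

Lemma reg_slope e : reg (chart e) (slope e).
Proof.
suff : @reg K (punctured_plane K) [set v | lcoord e (sval v) != 0]
    (fun v => lcoord (~~ e) (sval v) / lcoord e (sval v)).
  move=> H; apply: (@reg_ext K (punctured_plane K) _
    (fun v => lcoord (~~ e) (sval v) / lcoord e (sval v))).
    congr reg: H; apply/seteqP; split=> v /=; by rewrite chart_proj.
  by move=> v _; rewrite /= slope_proj.
have := reg_inv (reg_lcoord e); rewrite setTI => ri.
apply: reg_mul (ri); apply: reg_sub (reg_lcoord _) (reg_open ri) _.
by [].
Qed.

Lemma open_chart e : open (chart e).
Proof. exact: reg_open (reg_slope e). Qed.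

Lemma morph_line (X : fspace K) (A : set X) f g : reg A f -> reg A g ->
  (forall z, A z -> nonzero2 (f z) (g z)) ->
  morph_on A (fun z => line (f z) (g z)).
Proof.
move=> rf rg fg0.
have mp : @morph_on K X (punctured_plane K) A (fun z => ppoint (f z) (g z)).
  apply: morph_affine; first exact: reg_open rf.
  by move=> h [->|->]; [apply: reg_ext rf _|apply: reg_ext rg _] => z Az /=;
    rewrite ppointE //; exact: fg0.
exact: (morph_comp mp (morph_qproj (@collinear K)) (fun _ _ => I)).
Qed.

(* Sections of SL_2 -> P^1, M |-> [M_00 : M_10], over the two charts. *)
Definition chart_mx e (c : K) : 'M[K]_2 := if e then mx22 c (-1) 1 0 else lower c.

Lemma det_chart_mx e c : \det (chart_mx e c) = 1.
Proof. by case: e; rewrite det_mx22; ring. Qed.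

Lemma nonzero2_col (M : 'M[K]_2) : \det M = 1 -> nonzero2 (M 0 0) (M 1 0).
Proof.
move=> dM; rewrite /nonzero2 -negb_and; apply/negP => /andP[/eqP M0 /eqP M1].
by move/eqP: dM; rewrite detE2 M0 M1 mul0r mulr0 subr0 eq_sym oner_eq0.
Qed.

Lemma line_chart_mx e l : chart e l ->
  line (chart_mx e (slope e l) 0 0) (chart_mx e (slope e l) 1 0) = l.
Proof.
have [x [y [h ->]]] := line_surj l; rewrite chart_line // slope_line // => c0.
apply: line_eq => //; first exact/nonzero2_col/det_chart_mx.
by case: e c0; rewrite /chart_mx !mxE /= => c0;
  rewrite ?divfK ?mul1r ?mulr1 // mulrC divfK.
Qed.

End ProjectiveLine.

(** * The quotient P_a / B *)

Section Parabolic.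
Variables (K : fieldType) (D : root_datum) (G : km_group K D).
Implicit Types (a : simple D) (s t : 'I_(rdim D) -> K) (p u v b : G)
  (M N : 'M[K]_2).
Local Notation alpha a := (character (@simple_root D a)).
Local Notation ax := (km_axiomsP G).
Local Notation rad := Defs.rad.
Local Notation coord := Defs.coord.
Local Open Scope group_scope.

Lemma decomp1 a : decomp a (1 : G) 1%:M (fun=> 1%R) 1.
Proof.
split; [exact: det1|exact: torus1|by case: (rad_group G a)|].
by rewrite sl2_1 tor1; gsimp.
Qed.

(** The first column of M survives, so all [quad a i j] are multiplied by the same factor, alpha of
    the torus part of b. Their ratios therefore descend to P_a / B. *)
Lemma quad_mul_borel a i j p b : minpar G a p -> borel G b ->
  quad a i j (p * b) = (quad a i j p * quad a 0 0 b)%R.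
Proof.
move=> /minpar_decomp[M [t [u dp]]] /(borel_decomp a)[s [c [v [sT Rv ->]]]].
have [w dpb] := decomp_mul_borel c dp sT Rv.
have [w' db] := decomp_mul_borel c (decomp1 a) sT Rv.
rewrite mul1g in db; rewrite (quadE _ _ dp) (quadE _ _ dpb) (quadE _ _ db).
rewrite !characterM character1 mx22_1 /upper mul_mx22 [M]mx22E mul_mx22 !mxE /=.
by case: (i == 0); case: (j == 0); ring.
Qed.

Lemma quad_borel_neq0 a b : borel G b -> quad a 0 0 b != 0%R.
Proof.
move=> /(borel_decomp a)[s [c [v [sT Rv ->]]]].
have [w' db] := decomp_mul_borel c (decomp1 a) sT Rv.
rewrite mul1g in db; rewrite (quadE _ _ db) characterM character1 mx22_1 /upper.
by rewrite mul_mx22 !mxE /= !mul1r !mulr0 !addr0 !mul1r; exact: character_neq0.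
Qed.

(** Exhibits the character alpha of B as the restriction of an element of K[P_a]; the cocycle is
    regular for this reason. *)
Lemma quad_borel_tor a b t u : torus t -> unip G u ->
  quad a 0 0 (tor G t * u) = alpha a t.
Proof.
move=> tT; rewrite (unip_root ax a) => -[c _ [v Rv <-]].
have [w' db] := decomp_mul_borel c (decomp1 a) tT Rv.
rewrite mul1g in db; rewrite (quadE _ _ db) characterM character1 mx22_1 /upper.
by rewrite mul_mx22 !mxE /= !mul1r !mulr0 !addr0 !mul1r.
Qed.

(* The class of p in P_a / B = P^1. *)
Definition pcol a p : P1 K :=
  if quad a 0 0 p != 0%R then line (quad a 0 0 p) (quad a 1%R 0%R p)
  else line (quad a 0%R 1%R p) (quad a 1%R 1%R p).

(** The two pairs in [pcol] are the column (M_00, M_10) times M_00 alpha(t) and times M_10 alpha(t).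
    One of these factors is nonzero because det M = 1. *)
Lemma pcolE a p M t u : decomp a p M t u -> pcol a p = line (M 0 0)%R (M 1 0)%R.
Proof.
move=> dp; have [dM tT _ _] := dp; have x0 := character_neq0 (simple_root a) tT.
have h := nonzero2_col dM; rewrite /pcol !(quadE _ _ dp).
case: ifPn => [|/negPn]; rewrite !mulf_eq0 (negPf x0) orbF orbb.
  move=> M0; apply: line_eq => //; last by ring.
  by rewrite /nonzero2 !mulf_eq0 (negPf M0) (negPf x0).
move=> /eqP M0; have M1 : M 1%R 0%R != 0%R by move: h; rewrite /nonzero2 M0 eqxx.
apply: line_eq => //; last by ring.
by rewrite /nonzero2 orbC !mulf_eq0 (negPf M1) (negPf x0).
Qed.

(* Indices are written 1%R: in group_scope a bare 1 : 'I_2 is the neutral element 0. *)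
Lemma pcol_quad1 a p : minpar G a p -> quad a 1%R 1%R p != 0%R ->
  pcol a p = line (quad a 0%R 1%R p) (quad a 1%R 1%R p).
Proof.
move=> /minpar_decomp[M [t [u dp]]]; rewrite (pcolE dp) !(quadE _ _ dp) => h0.
have [dM tT _ _] := dp; have h := nonzero2_col dM.
apply: line_eq => //; last by ring.
by rewrite /nonzero2 h0 orbT.
Qed.

Lemma quad_neq0 a p : minpar G a p -> quad a 0 0 p != 0%R \/ quad a 1%R 1%R p != 0%R.
Proof.
move=> /minpar_decomp[M [t [u dp]]]; rewrite !(quadE _ _ dp).
have [dM tT _ _] := dp; have x0 := character_neq0 (simple_root a) tT.
by case/orP: (nonzero2_col dM) => M0; [left|right];
  rewrite !mulf_eq0 (negPf M0) (negPf x0).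
Qed.

Lemma pcol_sl2 a M : \det M = 1%R -> pcol a (sl2 G a M) = line (M 0 0)%R (M 1 0)%R.
Proof.
move=> dM; apply: (@pcolE a _ M (fun=> 1%R) 1); split=> //.
- exact: torus1.
- by case: (rad_group G a).
- by rewrite tor1; gsimp.
Qed.

Lemma pcol_mul_borel a p b : minpar G a p -> borel G b -> pcol a (p * b) = pcol a p.
Proof.
move=> /minpar_decomp[M [t [u dp]]] /(borel_decomp a)[s [c [v [sT Rv ->]]]].
have [w dpb] := decomp_mul_borel c dp sT Rv.
rewrite (pcolE dpb) (pcolE dp) /upper {1 2}[M]mx22E mul_mx22 !mxE /=.
by rewrite !mulr1 !mulr0 !addr0.
Qed.

(** Injectivity of P_a / B -> P^1. Proportional first columns make M^-1 N upper triangular, that is,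
    a value of the coroot times a root subgroup element, and the remaining factors of p^-1 g lie in
    T or U. *)
Lemma pcol_borel a p (g : G) : minpar G a p -> minpar G a g -> pcol a p = pcol a g ->
  borel G (p^-1 * g).
Proof.
move=> /minpar_decomp[M [t [u dp]]] /minpar_decomp[N [s [v dg]]].
rewrite (pcolE dp) (pcolE dg); case: dp dg => [dM tT Ru ->] [dN sT Rv ->].
move=> /(line_inj (nonzero2_col dM) (nonzero2_col dN)) E.
(* The adjugate of M, which is its inverse as det M = 1. *)
pose M' := (mx22 (M 1 1) (- M 0 1) (- M 1 0) (M 0 0))%R.
have M'M : (M' *m M)%R = 1%:M.
  rewrite /M' {5}[M]mx22E mul_mx22 mx22_1 -dM detE2; apply: mx22_inj; ring.
have dM' : \det M' = 1%R by rewrite det_mx22 -dM detE2; ring.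
have M'V : (sl2 G a M)^-1 = sl2 G a M'.
  apply: mulg1_eq; apply: (mulgI (sl2 G a M')).
  by rewrite mulgA -(sl2M ax) // M'M sl2_1 mul1g mulg1.
pose L := (M' *m N)%R.
have L10 : L 1%R 0%R = 0%R.
  rewrite /L /M' [N]mx22E mul_mx22 mxE /= mulNr addrC; apply/eqP.
  by rewrite subr_eq0 E mulrC.
have dL : \det L = 1%R by exact: det_mulmx1.
have dL' : (L 0%R 0%R * L 1%R 1%R = 1)%R.
  by move: dL; rewrite detE2 L10 mulr0 subr0.
have z0 : L 0%R 0%R != 0%R.
  by apply: contra_eq_neq dL' => ->; rewrite mul0r eq_sym oner_eq0.
have eL : L = (diag2 (L 0 0) *m upper (L 0 1 / L 0 0))%R.
  rewrite mul_mx22 {1}[L]mx22E L10; apply: mx22_inj;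
    rewrite ?(mulr0, mulr1, mul0r, addr0, add0r) //.
    by rewrite mulrC divfK.
  by rewrite -[LHS](mulKf z0) dL' mulr1.
have BT x : torus x -> borel G (tor G x) by exact: borel_maxtor.
have gB := borel_group G.
have -> : (sl2 G a M * tor G t * u)^-1 * (sl2 G a N * tor G s * v) =
    u^-1 * (tor G t)^-1 * (sl2 G a L * tor G s * v).
  by rewrite /L (sl2M ax) // -M'V; gsimp.
apply: (subgroupM gB); last apply: (subgroupM gB); last exact/borel_unip/unip_rad/Rv.
- apply: (subgroupM gB); apply: (subgroupV gB); last exact: BT.
  exact/borel_unip/unip_rad/Ru.
apply: (subgroupM gB); last exact: BT.
rewrite eL (sl2M ax) ?det_upper ?det_diag2 // (sl2_diag ax) //.
apply: (subgroupM gB); first exact/BT/torus_cochar.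
apply: borel_unip; rewrite (unip_root ax a); exists (L 0 1 / L 0 0)%R => //.
by exists 1; [case: (rad_group G a)|gsimp].
Qed.

(** Left multiplication by T acts on M through [conj2], which keeps M_00 and divides M_10 by
    alpha(s); this is the source of the inverse in the cocycle. *)
Lemma pcol_tor a p s x y : minpar G a p -> torus s -> nonzero2 x y ->
  pcol a p = line x y -> pcol a (tor G s * p) = line x ((alpha a s)^-1 * y)%R.
Proof.
move=> /minpar_decomp[M [t [u dp]]] sT h.
have x0 := character_neq0 (simple_root a) sT.
rewrite (pcolE dp) (pcolE (decomp_tor dp sT)) /conj2 !mxE /=.
case: dp => [dM _ _ _]; have hM := nonzero2_col dM => /(line_inj hM h) E.
have nz z w : nonzero2 z w -> nonzero2 z ((alpha a s)^-1 * w)%R.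
  by rewrite /nonzero2 mulf_eq0 invr_eq0 (negPf x0).
by apply: line_eq; [exact: nz|exact: nz|rewrite mulrCA E mulrCA].
Qed.

(** * Regular maps into P_a and B *)

Section RegularMaps.
Variable X : fspace K.
Implicit Types (A : set X) (f g : X -> G).

Definition regmap A a f := (forall x, A x -> minpar G a (f x)) /\
  forall h, coord G a h -> reg A (h \o f).

(** All simple roots are tested at once, since a Borel component produced with one root is used at
    the next factor with another root. *)
Definition bregmap A f := (forall x, A x -> borel G (f x)) /\
  forall a h, coord G a h -> reg A (h \o f).

Lemma regmap_open A a f : regmap A a f -> open A.
Proof. by case=> _ /(_ _ (coord_cst ax a 0%R)); exact: reg_open. Qed.

Lemma regmapM A a f g : regmap A a f -> regmap A a g ->
  regmap A a (fun x => f x * g x).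
Proof.
move=> rf [Pg rg]; have oA := regmap_open rf; have [Pf {}rf] := rf.
split=> [x Ax|h /(coord_comul ax)[s [cs hE]]].
  by apply: subgroupM (minpar_group ax a) _ _; [exact: Pf|exact: Pg].
apply: (@reg_ext K X A (fun x => \sum_(i < size s)
    (tnth (in_tuple s) i).1 (f x) * (tnth (in_tuple s) i).2 (g x)))%R.
  apply: reg_sum => // i _; have [c1 c2] := cs i.
  by apply: reg_mul; [exact: rf c1|exact: rg c2].
move=> x Ax; have := hE _ _ (Pf _ Ax) (Pg _ Ax); rewrite big_tnth => E.
exact: esym E.
Qed.

Lemma regmapV A a f : regmap A a f -> regmap A a (fun x => (f x)^-1).
Proof.
move=> [Pf rf]; split=> [x Ax|h ch].
  by apply: subgroupV (minpar_group ax a) _; exact: Pf.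
exact: rf (coord_antipode ax ch).
Qed.

Lemma regmap_cst A a p : open A -> minpar G a p -> regmap A a (fun=> p).
Proof. by move=> oA Pp; split=> // h _; exact: reg_const. Qed.

Lemma bregmap_regmap A a f : bregmap A f -> regmap A a f.
Proof. by move=> [Bf rf]; split=> [x /Bf|h /rf//]; exact: borel_minpar. Qed.

(** By [coord_borel] every P_a induces the same functions on B, so one root decides. *)
Lemma regmap_bregmap A a f : regmap A a f -> (forall x, A x -> borel G (f x)) ->
  bregmap A f.
Proof.
move=> [_ rf] Bf; split=> // b h /(coord_borel ax a)[h' ch' E].
apply: reg_ext (rf _ ch') _ => x Ax /=; rewrite E // inE; exact: Bf.
Qed.

Lemma regmap_sub A B a f : regmap A a f -> open B -> B `<=` A -> regmap B a f.
Proof.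
by move=> [Pf rf] oB BA; split=> [x /BA/Pf//|h /rf rh]; apply: reg_sub rh oB BA.
Qed.

(** [coord_levi] pulls K[P_a] back to regular functions on SL_2 x T, so only the entries of x |->
    (chart matrix, 1) have to be regular. *)
Lemma regmap_chart A a e c : reg A c ->
  regmap A a (fun x => sl2 G a (chart_mx e (c x))).
Proof.
move=> rc; have oA := reg_open rc.
have T1 : torus (fun=> 1%R) := @torus1 K (rdim D).
split=> [x _|h /(coord_levi ax) ch]; first exact/sl2_minpar/det_chart_mx.
pose F x : sl2_torus K (rdim D) :=
  exist _ (chart_mx e (c x), fun=> 1%R) (conj (det_chart_mx e (c x)) T1).
apply: (@reg_ext K X A (levi_pull G a h \o F)); last first.
  by move=> x _; rewrite /levi_pull /= tor1 mulg1.
apply: reg_comp ch _ => //; apply: morph_affine => // _ [[i [j ->]]|[k ->]]; last first.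
  exact: reg_const.
have := @reg_const K X A; case: e @F => F rcst.
  apply: (@reg_ext K X A (fun x => mx22 (c x) (-1) 1 0 i j)%R) => //.
  have -> : (fun x => mx22 (c x) (-1) 1 0 i j)%R = if i == 0%R then
      if j == 0%R then c else fun=> (-1)%R else if j == 0%R then fun=> 1%R else fun=> 0%R.
    by apply/funext => x; rewrite mxE; case: ifP; case: ifP.
  by case: ifP; case: ifP => // _ _; exact: rcst.
apply: (@reg_ext K X A (fun x => lower (c x) i j)%R) => //.
have -> : (fun x => lower (c x) i j)%R = if i == 0%R then
    if j == 0%R then fun=> 1%R else fun=> 0%R else if j == 0%R then c else fun=> 1%R.
  by apply/funext => x; rewrite mxE; case: ifP; case: ifP.
by case: ifP; case: ifP => // _ _; exact: rcst.
Qed.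

(** The case distinction in [pcol] is not open, but its second formula is valid on all of
    [quad a 1 1 != 0] by [pcol_quad1]. This set and [quad a 0 0 != 0] form an open cover, with one
    formula on each. *)
Lemma morph_pcol A a f : regmap A a f -> morph_on A (pcol a \o f).
Proof.
move=> [Pf rf]; have rq i j := rf _ (coord_quad G a i j).
have aux i (B := A `&` [set x | quad a i i (f x) != 0%R]) :
    morph_on B (fun x => line (quad a 0 i (f x)) (quad a 1%R i (f x))).
  have oB : open B by exact: open_neq0 (rq i i).
  have rB j : reg B (fun x => quad a j i (f x)) by apply: reg_sub (rq j i) oB _ => x [].
  apply: morph_line => // x [_ /=]; rewrite /nonzero2.
  case: i {rB oB} @B => -[|[|i]] hi //=.
    have -> : Ordinal hi = 0%R by exact: val_inj.
    by move=> ->.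
  have -> : Ordinal hi = 1%R by exact: val_inj.
  by move=> ->; rewrite orbT.
apply: morph_local => x Ax; case: (quad_neq0 (Pf x Ax)) => q0.
  exists (A `&` [set x | quad a 0 0 (f x) != 0%R]); eexists; split; last 2 first.
  - exact: aux.
  - by move=> y [_ /= yq]; rewrite /pcol yq.
  - by [].
  - by move=> y [].
exists (A `&` [set x | quad a 1%R 1%R (f x) != 0%R]); eexists; split; last 2 first.
- exact: aux.
- by move=> y [Ay /= yq]; rewrite pcol_quad1 //; exact: Pf.
- by [].
- by move=> y [].
Qed.

End RegularMaps.

Lemma bregmap_comp (X Y : fspace K) (A : set X) (B : set Y) (f : Y -> G) (g : X -> Y) :
  morph_on A g -> bregmap B f -> (forall x, A x -> B (g x)) -> bregmap A (f \o g).
Proof.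
move=> mg [Pf rf] AB; split=> [x /AB/Pf//|a h /rf rh].
exact: reg_comp mg rh AB.
Qed.

End Parabolic.

(** * Regularity of the degeneration *)

Section Interpolation.
Variables (K : fieldType) (D : root_datum) (G : km_group K D).
Variables (lambda : 'rV[int]_(rdim D)) (q : nat).
Hypothesis pchar0 : [pchar K] =i pred0.
Hypothesis q_gt0 : (0 < q)%N.
Hypothesis root_lambda : forall (a : simple D) (u : K), u != 0 ->
  character (simple_root a) (cochar lambda u) = u ^+ q.
Implicit Types (a : simple D) (b u : G) (z : K).
Local Notation ax := (km_axiomsP G).
Local Notation coord := Defs.coord.
Local Notation Psi := (@Psi K D G lambda).
Local Notation lam z := (tor G (cochar lambda z)).
Local Open Scope group_scope.

(** The interpolation nodes 1, 2, ... are distinct in characteristic 0. They avoid 0, where [Psi] is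
    not a conjugation. *)
Lemma natrS_inj : injective (fun i => i.+1%:R : K)%R.
Proof.
suff H i j : (i <= j)%N -> (i.+1%:R = j.+1%:R :> K)%R -> i = j.
  move=> i j E; have [ij|/ltnW ji] := leqP i j; first exact: H.
  by apply/esym; exact: H.
move=> ij E; apply/eqP; rewrite eqn_leq ij -subn_eq0 /= -subSS.
have /pcharf0P <- := pchar0.
by rewrite natrB // E subrr.
Qed.

Lemma natrS_neq0 i : (i.+1%:R != 0 :> K)%R.
Proof. by have /pcharf0P -> := pchar0. Qed.

(** The weights depend on f alone, so the bound N is uniform in u, as interpolation with fixed nodes
    demands. The constant term f(1) is what matches the value t of the projection at z = 0. *)
Lemma unip_conj_poly a f : coord G a f -> exists N, forall u, unip G u ->
  exists P : {poly K}, [/\ (size P <= N)%N, P.[0] = f 1%g &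
    forall z, z != 0 -> f (lam z * u * (lam z)^-1)%g = P.[z]]%R.
Proof.
move=> /(coord_weight ax)[s [cs E]].
pose h i := tnth (in_tuple s) i; pose d i := (q * \sum_b (h i).1 b)%N.
exists (\max_i d i).+1 => u Uu.
exists ((f 1%g)%:P + \sum_i (h i).2 u *: 'X^(d i))%R; split.
- apply: leq_trans (size_polyD _ _) _; rewrite geq_max.
  rewrite (leq_trans (size_polyC_leq1 _)) //=.
  apply: leq_trans (size_sum _ _ _) _.
  apply/bigmax_leqP => i _; apply: leq_trans (size_scale_leq _ _) _.
  by rewrite size_polyXn ltnS; exact: leq_bigmax.
(* Every exponent d i is positive, since q > 0 and the weight is nonzero; so only the constant
   survives at 0. *)
- rewrite hornerD hornerC horner_sum big1 ?addr0 // => i _.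
  rewrite hornerZ hornerXn expr0n; have [_ [b hb]] := cs i.
  by rewrite muln_eq0 eqn0Ngt q_gt0 (bigD1 b) //= addn_eq0 eqn0Ngt hb mulr0.
move=> z z0; rewrite E //; last exact: torus_cochar.
rewrite hornerD hornerC horner_sum big_tnth; congr (_ + _)%R.
apply: eq_bigr => i _; rewrite hornerZ hornerXn mulrC; congr (_ * _)%R.
rewrite /d exprM -prodrXr; apply: eq_bigr => b _.
by rewrite root_lambda.
Qed.

(** As lambda(z) commutes with t, Psi_z(t u) = t (lambda(z) u lambda(z)^-1), and the
    comultiplication separates t from the unipotent part. *)
Lemma Psi_poly a f : coord G a f -> exists N, forall b, borel G b ->
  exists2 P : {poly K}, (size P <= N)%N & forall z, f (Psi z b) = P.[z]%R.
Proof.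
move=> cf; have [s [cs E]] := coord_comul ax cf.
pose h i := tnth (in_tuple s) i.
have E' p p' : minpar G a p -> minpar G a p' ->
    f (p * p') = (\sum_i (h i).1 p * (h i).2 p')%R.
  by move=> Pp Pp'; rewrite E // big_tnth.
have /choice[N HN] i := unip_conj_poly (cs i).2.
exists (\max_i N i) => _ /borelP[t [u [tT Uu ->]]].
have /choice[P HP] i := HN i u Uu.
have Bt : minpar G a (tor G t) by apply: borel_minpar; exact: borel_maxtor.
have Bu v : unip G v -> minpar G a v by move=> Uv; exact/borel_minpar/borel_unip.
exists (\sum_i (h i).1 (tor G t) *: P i)%R.
  apply: leq_trans (size_sum _ _ _) _.
  apply/bigmax_leqP => i _; apply: leq_trans (size_scale_leq _ _) _.
  have [sP _ _] := HP i; exact: leq_trans sP (leq_bigmax _).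
move=> z; rewrite horner_sum; have [->|z0] := eqVneq z 0%R.
  (* Psi_0(t u) is written as t times 1, so that the comultiplication produces the constant terms of
     the P i. *)
  rewrite Psi0 borel_torE // -[tor G t]mulg1 E' //; last first.
    by apply: Bu; case: (unip_group ax).
  rewrite mulg1.
  by apply: eq_bigr => i _; rewrite hornerZ; have [_ -> _] := HP i.
have zT := torus_cochar lambda z0.
have -> : Psi z (tor G t * u) = tor G t * (lam z * u * (lam z)^-1).
  by rewrite PsiE // !mulgA [lam z * tor G t]tor_comm.
rewrite E' //; last exact/Bu/unip_conj.
by apply: eq_bigr => i _; rewrite hornerZ; have [_ _ ->] := HP i.
Qed.

(* The coefficients of the polynomial z |-> f (Psi z b) are recovered from its
   values at finitely many z != 0, so they are elements of K[P_a]. *)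
Lemma Psi_interpolation a f : coord G a f ->
  exists N (L : 'I_N -> {poly K}), forall z b, borel G b ->
    f (Psi z b) = (\sum_i (L i).[z] *
      f (lam i.+1%:R * b * (lam i.+1%:R)^-1)%g)%R.
Proof.
move=> /Psi_poly[N HN]; pose x i : K := i.+1%:R%R.
exists N.+1, (fun i => tnth (lagrange N.+1 x) i : {poly K}) => z b Bb.
have [P sP HP] := HN b Bb.
rewrite HP [in LHS](@lagrange_gen _ _ x _ natrS_inj _ (leqW sP)) // horner_sum.
apply: eq_bigr => i _; rewrite hornerM hornerC mulrC; congr (_ * _)%R.
by rewrite -HP PsiE //; exact: natrS_neq0.
Qed.

Lemma bregmap_Psi (X : fspace K) (A : set X) (f : X -> G) (c : X -> K) :
  open A -> reg A c -> bregmap A f -> bregmap A (fun x => Psi (c x) (f x)).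
Proof.
move=> oA rc rf; have [Bf _] := rf.
split=> [x /Bf|a h ch]; first exact: Psi_borel.
have [N [L HL]] := Psi_interpolation ch.
apply: (@reg_ext K X A (fun x => \sum_i (L i).[c x] *
    h (lam i.+1%:R * f x * (lam i.+1%:R)^-1)%g)%R); last first.
  by move=> x /Bf Bx; rewrite /= HL.
apply: reg_sum => // i _; apply: reg_mul; first exact: reg_horner.
have Pl : minpar G a (lam i.+1%:R%R).
  by apply/borel_minpar/borel_maxtor/torus_cochar; exact: natrS_neq0.
have rl := regmap_cst oA Pl.
by case: (regmapM (regmapM rl (bregmap_regmap a rf)) (regmapV rl)) => _ /(_ _ ch).
Qed.

End Interpolation.

(** * The family and its central fibre *)

Section Family.
Variables (K : fieldType) (D : root_datum) (G : km_group K D).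
Variables (lambda : 'rV[int]_(rdim D)) (q : nat).
Hypothesis pchar0 : [pchar K] =i pred0.
Hypothesis q_gt0 : (0 < q)%N.
Hypothesis root_lambda : forall (a : simple D) (u : K), u != 0 ->
  character (simple_root a) (cochar lambda u) = u ^+ q.
Local Notation coord := Defs.coord.
Local Notation Psi := (@Psi K D G lambda).
Local Notation Cov w := (@family_cover K D G _ w).
Local Notation Fam w := (@toric_family K D G lambda _ w).
Local Notation Lim w := (@toric_limit K D G lambda _ w).
Local Notation proj := (@qproj K _ (@family_orbit K D G lambda _ _)).
Local Notation base := (@family_proj K D G lambda _ _).
Local Open Scope group_scope.

(** The sequence b is indexed from 0: the last of k components is b (k - 1), and 1 stands in when
    there is none. *)
Definition borel_last (b : nat -> G) k : G := if k is j.+1 then b j else 1.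

Definition prev (b : nat -> G) (u : K) k : G := if k is j.+1 then Psi u (b j) else 1.

Lemma prevE b u k : prev b u k = Psi u (borel_last b k).
Proof. by case: k => //=; rewrite Psi1. Qed.

Lemma borel_lastP b k : (forall k, borel G (b k)) -> borel G (borel_last b k).
Proof. by case: k => //= _; case: (borel_group G). Qed.

(** * The twisted action of B^r and its local sections *)

Section Orbits.
Variables (r : nat) (w : r.-tuple (simple D)).
Implicit Types x y z : Cov w.

(** The orbit relation with its group element exposed, because [lt_acts] must say how [lt_borel]
    changes with b. *)
Definition acts (b : nat -> G) x y :=
  [/\ forall k, borel G (b k), (sval y).1 = (sval x).1
    & forall k : 'I_r, (sval y).2 k = (prev b (sval x).1 k)^-1 * (sval x).2 k * b k].

Lemma acts1 x : acts (fun=> 1) x x.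
Proof.
split=> // [_|k]; first by case: (borel_group G).
have -> : prev (fun=> 1) (sval x).1 k = 1 by case: (val k) => //= _; rewrite Psi1.
by gsimp.
Qed.

(** Psi_u is a homomorphism on B for every u, including 0, so the twisted formula defines a group
    action. *)
Lemma actsM b c x y z : acts b x y -> acts c y z -> acts (fun k => b k * c k) x z.
Proof.
move=> [Bb xy E] [Bc yz F]; split=> [k||k]; last 1 first.
- rewrite F E xy; have -> : prev (fun k => b k * c k) (sval x).1 k =
      prev b (sval x).1 k * prev c (sval x).1 k.
    by case: (val k) => [|j] /=; rewrite ?mulg1 // PsiM.
  by gsimp.
- exact: subgroupM (borel_group G) _ _.
- by rewrite yz.
Qed.

Lemma actsV b x y : acts b x y -> acts (fun k => (b k)^-1) y x.
Proof.
move=> [Bb xy E]; split=> [k||k]; last 1 first.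
- have -> : prev (fun k => (b k)^-1) (sval y).1 k = (prev b (sval x).1 k)^-1.
    rewrite xy; apply/esym; apply: mulg1_eq.
    case: (val k) => [|j] /=; first by rewrite mulg1.
    rewrite -PsiM ?mulgV ?Psi1 //; exact: subgroupV (borel_group G) _.
  by rewrite E; gsimp.
- exact: subgroupV (borel_group G) _.
- by rewrite xy.
Qed.

Lemma projP x y : proj x = proj y <-> exists b, acts b x y.
Proof.
apply: qprojP => {x y} [x|x y [b xy]|x y z [b xy] [c yz]].
- by exists (fun=> 1); exact: acts1.
- by exists (fun k => (b k)^-1); exact: actsV.
- by exists (fun k => b k * c k); exact: actsM xy yz.
Qed.

Lemma base_proj x : base (proj x) = (sval x).1.
Proof.
rewrite /family_proj; case: xgetP => [u _ [y /projP[b [_ -> _]] <-] //|].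
by move=> /(_ (sval x).1) []; exists x.
Qed.

Lemma reg_base : @reg K (Cov w) setT (fun x => (sval x).1).
Proof. by apply: reg_affine; left. Qed.

Lemma reg_family_proj : @reg K (Fam w) setT base.
Proof.
suff : @reg K (Cov w) setT (fun x => base (proj x)) by [].
by apply: reg_ext reg_base _ => x _; rewrite base_proj.
Qed.

Lemma regmap_coord (k : 'I_r) :
  @regmap K D G (Cov w) setT (tnth w k) (fun x => (sval x).2 k).
Proof.
split=> [x _|h ch]; first exact: svalP x k.
by apply: reg_affine; right; exists k, h.
Qed.

(* A section of [proj] over an open set, with the last component [lt_borel x] of
   the element of B^r carrying the section to [x]. *)
Record local_triv := LocalTriv {
  lt_dom : set (Fam w);
  lt_sec : Fam w -> Cov w;
  lt_borel : Cov w -> G;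
  lt_sec_morph : morph_on lt_dom lt_sec;
  lt_secK : forall x : Fam w, lt_dom x -> proj (lt_sec x) = x;
  lt_sec_base : forall x : Fam w, (sval (lt_sec x)).1 = base x;
  lt_bregmap : bregmap (proj @^-1` lt_dom) lt_borel;
  lt_acts : forall b x y, lt_dom (proj x) -> acts b x y ->
    lt_borel y = lt_borel x * borel_last b r;
  lt_borel_sec : forall x : Fam w, lt_dom x -> lt_borel (lt_sec x) = 1
}.

Lemma lt_open i : open (lt_dom i).
Proof. exact: morph_open (lt_sec_morph i). Qed.

End Orbits.

(** Without factors the family is A^1, and [base] provides a global section. *)
Lemma local_triv_nil (w : 0.-tuple (simple D)) x : exists i : local_triv w, lt_dom i x.
Proof.
have P0 u : forall k : 'I_0, minpar G (tnth w k) (((u, fun=> 1) : K * ('I_0 -> G)).2 k).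
  by case.
unshelve eexists (@LocalTriv _ w setT (fun x => exist _ (base x, fun=> 1) (P0 _))
  (fun=> 1) _ _ _ _ _ _) => //.
- apply: morph_affine; first exact: openT.
  by move=> h [->|[[]//]]; exact: reg_family_proj.
- move=> y _; have [c <-] := qproj_surj y; apply/projP; exists (fun=> 1).
  by split=> [k||[]//]; [case: (borel_group G)|rewrite /= base_proj].
- split=> [y _|a h _]; first by case: (borel_group G).
  exact: reg_const openT.
- by move=> b y z _ _; rewrite /= mulg1.
Qed.

(** * Passing from r to r+1 factors *)

Section Step.
Variables (r : nat) (w : r.+1.-tuple (simple D)).
Definition tuple_init : r.-tuple (simple D) := [tuple tnth w (lift ord_max k) | k < r].
Local Notation w' := tuple_init.
Local Notation a := (tnth w ord_max).

Lemma tnth_init k : tnth w' k = tnth w (lift ord_max k).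
Proof. by rewrite tnth_mktuple. Qed.

Lemma trunc_subproof (x : Cov w) (k : 'I_r) :
  minpar G (tnth w' k) ((sval x).2 (lift ord_max k)).
Proof. by rewrite tnth_init; exact: svalP x _. Qed.

Definition trunc (x : Cov w) : Cov w' :=
  exist _ ((sval x).1, fun k => (sval x).2 (lift ord_max k)) (trunc_subproof x).

Definition snoc_fun (f : 'I_r -> G) (g : G) (k : 'I_r.+1) : G :=
  if unlift ord_max k is Some j then f j else g.

Lemma snoc_subproof (x : Cov w') g : minpar G a g ->
  forall k, minpar G (tnth w k) (snoc_fun (sval x).2 g k).
Proof.
move=> Pg k; rewrite /snoc_fun; case: unliftP => [j|] -> //.
by rewrite -tnth_init; exact: svalP x j.
Qed.

Definition snoc (x : Cov w') g (Pg : minpar G a g) : Cov w :=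
  exist _ ((sval x).1, snoc_fun (sval x).2 g) (snoc_subproof x Pg).

Lemma snoc_lift f g j : snoc_fun f g (lift ord_max j) = f j.
Proof. by rewrite /snoc_fun liftK. Qed.

Lemma snoc_max f g : snoc_fun f g ord_max = g.
Proof. by rewrite /snoc_fun unlift_none. Qed.

Lemma trunc_snoc x g (Pg : minpar G a g) : trunc (snoc x Pg) = x.
Proof.
case: x => [[u f] Pf]; apply: eq_exist => /=; congr pair.
by apply/funext => k; rewrite snoc_lift.
Qed.

Lemma morph_trunc : @morph_on K (Cov w) (Cov w') setT trunc.
Proof.
apply: morph_affine; first exact: openT.
move=> h [->|[k [f [cf ->]]]]; first exact: reg_base.
by rewrite tnth_init in cf; exact: (regmap_coord w (lift ord_max k)).2.
Qed.

Lemma morph_snoc (Z : fspace K) (A : set Z) (s : Z -> Cov w') (g : Z -> G)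
    (Pg : forall z, minpar G a (g z)) : morph_on A s -> regmap A a g ->
  @morph_on K Z (Cov w) A (fun z => snoc (s z) (Pg z)).
Proof.
move=> ms rg; apply: morph_affine; first exact: morph_open ms.
move=> h [->|[k [f [cf ->]]]]; first exact: (reg_comp ms (reg_base w') (fun _ _ => I)).
case: (unliftP ord_max k) cf => [j ->|->] cf.
  rewrite -tnth_init in cf.
  apply: reg_ext (reg_comp ms ((regmap_coord w' j).2 _ cf) (fun _ _ => I)) _.
  by move=> z Az /=; rewrite snoc_lift.
apply: reg_ext (rg.2 _ cf) _.
by move=> z Az /=; rewrite snoc_max.
Qed.

Lemma acts_trunc b (x y : Cov w) : acts b x y -> acts b (trunc x) (trunc y).
Proof.
by move=> [Bb xy E]; split=> // k; rewrite /= E lift_max.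
Qed.

Definition qtrunc (x : Fam w) : Fam w' := proj (trunc (qrep x)).

Lemma qtrunc_proj x : qtrunc (proj x) = proj (trunc x).
Proof.
have /projP[b xy] := qrepK (proj x).
by apply/projP; exists b; exact: acts_trunc.
Qed.

Lemma base_qtrunc x : base (qtrunc x) = base x.
Proof. by rewrite -{2}[x]qrepK /qtrunc !base_proj. Qed.

Lemma morph_qtrunc : morph_on setT qtrunc.
Proof.
have mp := morph_comp morph_trunc (morph_qproj (@family_orbit K D G lambda _ w'))
  (fun _ _ => I).
apply: morph_quot; rewrite preimage_setT; apply: morph_ext mp _ => x _.
by rewrite /= qtrunc_proj.
Qed.

Section Fibre.
Variable i : local_triv w'.
Local Notation dom := (lt_dom i).

(* The last component of x once the first ones have been moved to the section. *)
Definition straight (x : Cov w) : G :=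
  Psi (sval x).1 (lt_borel i (trunc x)) * (sval x).2 ord_max.

Definition fibre (x : Fam w) : P1 K := pcol a (straight (qrep x)).

Local Notation Dom := (proj @^-1` (qtrunc @^-1` dom) : set (Cov w)).

Lemma DomE x : Dom x = dom (proj (trunc x)).
Proof. by rewrite /= qtrunc_proj. Qed.

Lemma Dom_open : open Dom.
Proof.
have := morph_qtrunc.1 _ (@lt_open _ _ i); rewrite setTI => oD.
by have := (morph_qproj _).1 _ oD; rewrite setTI.
Qed.

(** The regularity of [Psi] across u = 0 enters here, through [bregmap_Psi]. *)
Lemma regmap_straight : regmap Dom a straight.
Proof.
have oD := Dom_open.
have mt : morph_on Dom trunc by apply: morph_sub morph_trunc oD _.
apply: regmapM; last by apply: regmap_sub (regmap_coord w ord_max) oD _.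
apply: bregmap_regmap; apply: (bregmap_Psi pchar0 q_gt0 root_lambda oD).
  by apply: reg_sub (reg_base w) oD _.
by apply: bregmap_comp mt (lt_bregmap i) _ => x; rewrite DomE.
Qed.

(** The twist Psi_u(b_(r-1))^-1 on the last component cancels against the change of [lt_borel]. What
    remains is right multiplication by B, which [pcol] does not see; so [fibre] is well defined on
    orbits. *)
Lemma straight_acts b x y : Dom x -> acts b x y -> straight y = straight x * b r.
Proof.
move=> Dx xy; have [Bb e E] := xy; rewrite DomE in Dx.
have Bx : borel G (lt_borel i (trunc x)) by exact: (lt_bregmap i).1.
rewrite /straight (lt_acts Dx (acts_trunc xy)) E e prevE /= PsiM //.
  by gsimp.
exact: borel_lastP.
Qed.

Lemma fibre_proj x : Dom x -> fibre (proj x) = pcol a (straight x).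
Proof.
move=> Dx; have /esym/projP[b xy] := qrepK (proj x).
rewrite /fibre (straight_acts Dx xy) pcol_mul_borel //.
  exact: regmap_straight.1.
by case: xy.
Qed.

Lemma morph_fibre : morph_on (qtrunc @^-1` dom) fibre.
Proof.
apply: morph_quot; apply: morph_ext (morph_pcol regmap_straight) _ => x Dx.
by rewrite /= fibre_proj.
Qed.

Lemma fibre_borel x g : Dom x -> minpar G a g -> pcol a g = fibre (proj x) ->
  borel G (g^-1 * straight x).
Proof.
move=> Dx Pg; rewrite fibre_proj // => E.
by apply: pcol_borel E => //; exact: regmap_straight.1.
Qed.

(** Any lift g of the fibre coordinate recovers the point. Local sections, the inverse
    trivialization and its independence of the chart all rest on this freedom in g. *)
Lemma proj_snoc_sec x g (Pg : minpar G a g) : Dom x ->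
  pcol a g = fibre (proj x) ->
  proj (snoc (lt_sec i (proj (trunc x))) Pg) = proj x.
Proof.
move=> Dx E; have Bx := fibre_borel Dx Pg E.
have Dx' := Dx; rewrite DomE in Dx'.
have /projP[b sx] := lt_secK Dx'.
have [Bb e F] := sx.
(* [lt_borel] equals 1 on the section, so at [trunc x] it is the last component of the element b
   coming from the section. *)
have hb : lt_borel i (trunc x) = borel_last b r.
  rewrite (lt_acts _ sx); last by rewrite lt_secK.
  by rewrite lt_borel_sec // mul1g.
(* The first r components carry the section to [trunc x]; component r is the element of B taking g
   to [straight x]. *)
apply/projP; exists (fun k => if (k < r)%N then b k else g^-1 * straight x).
have prevb u k : (k <= r)%N ->
    prev (fun k => if (k < r)%N then b k else g^-1 * straight x) u k = prev b u k.
  by case: k => //= k ->.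
split=> [k|//|k]; first by case: ifP.
case: (unliftP ord_max k) => [j|] ->.
  have bj : bump r j = j := lift_max j.
  by rewrite /= snoc_lift bj ltn_ord prevb -?F // ltnW.
rewrite /= snoc_max ltnn prevb // prevE /straight hb /= -e.
by gsimp.
Qed.

Section Extend.
Variable e : bool.
Definition chart_lift (l : P1 K) : G := sl2 G a (chart_mx e (slope e l)).

Lemma minpar_chart_lift l : minpar G a (chart_lift l).
Proof. exact/sl2_minpar/det_chart_mx. Qed.

Lemma pcol_chart_lift l : chart e l -> pcol a (chart_lift l) = l.
Proof. by move=> cl; rewrite pcol_sl2 ?det_chart_mx // line_chart_mx. Qed.

Lemma regmap_chart_lift (Z : fspace K) (A : set Z) (l : Z -> P1 K) :
  morph_on A l -> (forall z, A z -> chart e (l z)) ->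
  regmap A a (fun z => chart_lift (l z)).
Proof.
move=> ml Al; apply: (@regmap_chart _ _ _ _ _ a e (slope e \o l)).
exact: (reg_comp ml (@reg_slope K e) Al).
Qed.

Definition ext_dom : set (Fam w) := qtrunc @^-1` dom `&` fibre @^-1` (@chart K e).

Definition ext_sec (x : Fam w) : Cov w :=
  snoc (lt_sec i (qtrunc x)) (minpar_chart_lift (fibre x)).

(** The discrepancy in B between [straight x] and the regular lift of its class: the last component
    for r+1 factors, with which the induction continues. *)
Definition ext_borel (x : Cov w) : G := (chart_lift (fibre (proj x)))^-1 * straight x.

Lemma ext_open : open ext_dom.
Proof. exact: morph_fibre.1 _ (@open_chart K e). Qed.

Lemma ext_sec_morph : morph_on ext_dom ext_sec.
Proof.
apply: (morph_snoc (s := fun x => lt_sec i (qtrunc x))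
  (g := fun x => chart_lift (fibre x))).
  apply: (@morph_comp _ _ _ _ _ dom qtrunc (lt_sec i)) (lt_sec_morph i) _.
    exact: morph_sub morph_qtrunc ext_open _.
  by move=> x [].
apply: regmap_chart_lift; last by move=> x [].
by apply: morph_sub morph_fibre ext_open _ => x [].
Qed.

Lemma ext_secK x : ext_dom x -> proj (ext_sec x) = x.
Proof.
move=> [dx cx]; have [c xc] := qproj_surj x; rewrite -xc in dx cx *.
rewrite /ext_sec; move: (minpar_chart_lift _); rewrite [qtrunc _]qtrunc_proj => Pg.
by apply: proj_snoc_sec => //; exact: pcol_chart_lift.
Qed.

Lemma ext_sec_base x : (sval (ext_sec x)).1 = base x.
Proof. by rewrite /= lt_sec_base base_qtrunc. Qed.

Lemma ext_bregmap : bregmap (proj @^-1` ext_dom) ext_borel.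
Proof.
have oE : open (proj @^-1` ext_dom).
  by have := (morph_qproj _).1 _ ext_open; rewrite setTI.
have ED : proj @^-1` ext_dom `<=` Dom by move=> x [].
have rg : regmap (proj @^-1` ext_dom) a (fun x => chart_lift (fibre (proj x))).
  apply: regmap_chart_lift; last by move=> x [].
  apply: (@morph_comp _ _ _ _ _ (qtrunc @^-1` dom) proj fibre) morph_fibre _.
    by apply: morph_sub (morph_qproj _) oE _.
  by move=> x [].
apply: (@regmap_bregmap _ _ _ _ _ a).
  apply: regmapM (regmapV rg) _.
  exact: regmap_sub regmap_straight oE ED.
move=> x [Dx cx]; apply: fibre_borel => //; first exact: minpar_chart_lift.
exact: pcol_chart_lift.
Qed.

Lemma ext_acts b x y : ext_dom (proj x) -> acts b x y ->
  ext_borel y = ext_borel x * borel_last b r.+1.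
Proof.
move=> [Dx cx] xy; rewrite /ext_borel (straight_acts Dx xy) mulgA.
by have -> : proj y = proj x by apply/esym/projP; exists b.
Qed.

Lemma ext_borel_sec x : ext_dom x -> ext_borel (ext_sec x) = 1.
Proof.
move=> dx; have [dx' cx] := dx; rewrite /ext_borel ext_secK // /straight /ext_sec.
by rewrite trunc_snoc /= lt_borel_sec // Psi1 mul1g snoc_max mulVg.
Qed.

Definition ext_triv : local_triv w :=
  LocalTriv ext_sec_morph ext_secK ext_sec_base ext_bregmap ext_acts ext_borel_sec.

End Extend.

(** A set-theoretic lift P^1 -> P_a jumping between the two charts. The class in [fibre_inv] does
    not depend on the lift, so this does no harm to regularity. *)
Definition p1_lift (l : P1 K) : G := chart_lift (~~ `[< @chart K false l >]) l.

Lemma minpar_p1_lift l : minpar G a (p1_lift l).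
Proof. exact: minpar_chart_lift. Qed.

Lemma pcol_p1_lift l : pcol a (p1_lift l) = l.
Proof.
apply: pcol_chart_lift; case: asboolP => //= nc; by case: (chart_cover l).
Qed.

Definition fibre_inv (x : Fam w') (l : P1 K) : Fam w :=
  proj (snoc (lt_sec i x) (minpar_p1_lift l)).

Lemma base_fibre_inv x l : base (fibre_inv x l) = base x.
Proof. by rewrite base_proj /= lt_sec_base. Qed.

Lemma qtrunc_fibre_inv x l : dom x -> qtrunc (fibre_inv x l) = x.
Proof. by move=> dx; rewrite /fibre_inv qtrunc_proj trunc_snoc lt_secK. Qed.

Lemma fibre_fibre_inv x l : dom x -> fibre (fibre_inv x l) = l.
Proof.
move=> dx; rewrite fibre_proj; last by rewrite DomE trunc_snoc lt_secK.
by rewrite /straight trunc_snoc lt_borel_sec // Psi1 mul1g /= snoc_max pcol_p1_lift.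
Qed.

Lemma fibre_invK x : dom (qtrunc x) -> fibre_inv (qtrunc x) (fibre x) = x.
Proof.
have [c <-] := qproj_surj x => dx; rewrite /fibre_inv.
move: (minpar_p1_lift _); rewrite [qtrunc _]qtrunc_proj => Pg.
by apply: proj_snoc_sec => //; exact: pcol_p1_lift.
Qed.

Lemma morph_fibre_inv (Z : fspace K) (A : set Z) (f : Z -> Fam w') (l : Z -> P1 K) :
  morph_on A f -> morph_on A l -> (forall z, A z -> dom (f z)) ->
  morph_on A (fun z => fibre_inv (f z) (l z)).
Proof.
move=> mf ml Af.
have aux e (B := A `&` l @^-1` (@chart K e)) : @morph_on K Z (Fam w) B (fun z =>
    proj (snoc (lt_sec i (f z)) (minpar_chart_lift e (l z)))).
  have oB : open B by exact: ml.1 _ (@open_chart K e).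
  apply: (@morph_comp _ _ (Cov w) (Fam w) B setT (fun z =>
    snoc (lt_sec i (f z)) (minpar_chart_lift e (l z))) proj) (morph_qproj _) _ => //.
  apply: (morph_snoc (s := fun z => lt_sec i (f z)) (g := fun z => chart_lift e (l z))).
    apply: (@morph_comp _ _ _ _ _ dom f (lt_sec i)) (lt_sec_morph i) _.
      by apply: morph_sub mf oB _ => z [].
    by move=> z [/Af].
  apply: regmap_chart_lift; last by move=> z [].
  by apply: morph_sub ml oB _ => z [].
apply: morph_local => z Az.
have [e ce] : exists e, chart e (l z).
  by case: (chart_cover (l z)); [exists false|exists true].
exists (A `&` l @^-1` (@chart K e)); eexists; split; last 2 first.
- exact: aux.
- move=> y [Ay cy]; have dy := Af _ Ay; rewrite /fibre_inv.
  (* The point built with the regular lift of one chart; [proj_snoc_sec] identifies its class with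
     the one built from [p1_lift]. *)
  set x := snoc _ (minpar_chart_lift _ _).
  have Dx : Dom x by rewrite DomE trunc_snoc lt_secK.
  have := @proj_snoc_sec x _ (minpar_p1_lift (l y)) Dx.
  rewrite trunc_snoc lt_secK // => -> //.
  rewrite pcol_p1_lift fibre_proj // /straight trunc_snoc lt_borel_sec //.
  by rewrite Psi1 mul1g /= snoc_max pcol_chart_lift.
- by split.
- by move=> y [].
Qed.

End Fibre.

Lemma local_triv_step : (forall x, exists i : local_triv w', lt_dom i x) ->
  forall x, exists i : local_triv w, lt_dom i x.
Proof.
move=> H x; have [i di] := H (qtrunc x).
by case: (chart_cover (fibre i x)) => ce;
  [exists (ext_triv i false)|exists (ext_triv i true)].
Qed.

End Step.

Lemma local_triv_cover r (w : r.-tuple (simple D)) x :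
  exists i : local_triv w, lt_dom i x.
Proof.
elim: r w x => [|r IHr] w x; first exact: local_triv_nil.
by apply: local_triv_step => y; exact: IHr.
Qed.

Lemma limit_nil (w : 0.-tuple (simple D)) : bott_tower 0 (Lim w).
Proof.
have P0 : forall k : 'I_0, minpar G (tnth w k) (((0%R, fun=> 1) : K * ('I_0 -> G)).2 k).
  by case.
pose c0 : Cov w := exist _ (0%R, fun=> 1) P0.
have b0 : base (proj c0) = 0%R by rewrite base_proj.
pose y0 : Lim w := exist _ (proj c0) b0.
have yE (y : Lim w) : y = y0.
  case: y => x hx; apply: eq_exist; have [c xc] := qproj_surj x.
  rewrite -xc in hx *; rewrite /= base_proj in hx.
  apply/projP; exists (fun=> 1); split=> [k||[]//]; last by rewrite hx.
  by case: (borel_group G).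
apply: (@BottPoint K (Lim w) (fun=> tt)).
exists (fun=> y0); split.
- exact: morph_cst openT.
- exact: morph_cst openT.
- by move=> y _; split=> //; rewrite (yE y).
- by move=> [].
Qed.

(** * The limit as a projective bundle over the shorter limit *)

Section Stage.
Variables (r : nat) (w : r.+1.-tuple (simple D)).
Local Notation w' := (tuple_init w).
Local Notation a := (tnth w ord_max).
Implicit Types i j : local_triv w'.

Definition transition i j (y : Fam w') : K :=
  ((quad a 0 0 (lt_borel i (qrep y)))^-1 * quad a 0 0 (lt_borel j (qrep y)))%R.

(** Another representative multiplies both [lt_borel] values on the right by the same element of B;
    [quad a 0 0] is multiplicative there, and the common factor cancels. *)
Lemma transition_proj i j c : lt_dom i (proj c) -> lt_dom j (proj c) ->
  transition i j (proj c) =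
  ((quad a 0 0 (lt_borel i c))^-1 * quad a 0 0 (lt_borel j c))%R.
Proof.
move=> di dj; have /esym/projP[b cy] := qrepK (proj c); have [Bb _ _] := cy.
have Bl := borel_lastP r Bb.
have Bi : borel G (lt_borel i c) by exact: (lt_bregmap i).1.
have Bj : borel G (lt_borel j c) by exact: (lt_bregmap j).1.
rewrite /transition (lt_acts di cy) (lt_acts dj cy).
rewrite !quad_mul_borel //; try exact: borel_minpar.
by rewrite [LHS]mulrC -mulf_div divff ?quad_borel_neq0 // mulr1 mulrC.
Qed.

Lemma reg_transition i j : reg (lt_dom i `&` lt_dom j) (transition i j).
Proof.
have oij : open (lt_dom i `&` lt_dom j).
  by apply: openI; [exact: (@lt_open _ _ i)|exact: (@lt_open _ _ j)].
have oc : @open (Cov w') (proj @^-1` (lt_dom i `&` lt_dom j)).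
  by have := (morph_qproj _).1 _ oij; rewrite setTI.
have ri : reg (proj @^-1` (lt_dom i `&` lt_dom j)) (quad a 0 0 \o lt_borel i).
  by apply: reg_sub ((lt_bregmap i).2 _ _ (coord_quad G a 0 0)) oc _ => c [].
have rj : reg (proj @^-1` (lt_dom i `&` lt_dom j)) (quad a 0 0 \o lt_borel j).
  by apply: reg_sub ((lt_bregmap j).2 _ _ (coord_quad G a 0 0)) oc _ => c [].
suff : @reg K (Cov w') (proj @^-1` (lt_dom i `&` lt_dom j))
  (transition i j \o proj) by [].
have ri' : reg (proj @^-1` (lt_dom i `&` lt_dom j))
    (fun c => (quad a 0 0 (lt_borel i c))^-1)%R.
  apply: reg_invN0 ri _ => c [di _]; apply: quad_borel_neq0.
  exact: (lt_bregmap i).1.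
apply: reg_ext (reg_mul ri' rj) _ => c [di dj].
by rewrite /= transition_proj.
Qed.

Lemma transition_neq0 i y : lt_dom i y -> quad a 0 0 (lt_borel i (qrep y)) != 0%R.
Proof.
by move=> di; apply: quad_borel_neq0; apply: (lt_bregmap i).1; rewrite /= qrepK.
Qed.

Definition limit_dom i : set (Lim w') := sval @^-1` lt_dom i.

Lemma limit_dom_open i : open (limit_dom i).
Proof.
have ms := morph_sval (base @^-1` [set 0%R] : set (Fam w')).
by have := ms.1 _ (@lt_open _ _ i); rewrite setTI.
Qed.

Lemma limit_dom_cover (y : Lim w') : exists i, limit_dom i y.
Proof. exact: local_triv_cover. Qed.

Lemma reg_limit_transition i j :
  reg (limit_dom i `&` limit_dom j) (fun y => transition i j (sval y)).
Proof.
have ms := morph_sval (base @^-1` [set 0%R] : set (Fam w')).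
by have := ms.2 _ _ (reg_transition i j); rewrite setTI.
Qed.

Lemma transition_id i (y : Lim w') : limit_dom i y -> transition i i (sval y) = 1%R.
Proof. by move=> di; rewrite /transition mulVf // transition_neq0. Qed.

Lemma transition_cocycle i j k (y : Lim w') :
  limit_dom i y -> limit_dom j y -> limit_dom k y ->
  (transition i j (sval y) * transition j k (sval y))%R = transition i k (sval y).
Proof.
by move=> di dj dk; rewrite /transition -mulrA mulVKf // transition_neq0.
Qed.

Definition limit_bundle : line_bundle (Lim w') :=
  LineBundle limit_dom_open limit_dom_cover reg_limit_transition
    transition_id transition_cocycle.

Lemma limit_trunc_subproof (y : Lim w) : base (qtrunc (sval y)) = 0%R.
Proof. by rewrite base_qtrunc; exact: svalP y. Qed.

Definition limit_trunc (y : Lim w) : Lim w' := exist _ _ (limit_trunc_subproof y).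

Lemma limit_inv_subproof i (x : Lim w') (l : P1 K) :
  base (fibre_inv i (sval x) l) = 0%R.
Proof. by rewrite base_fibre_inv; exact: svalP x. Qed.

Definition limit_inv i (x : prod_space (Lim w') (P1 K)) : Lim w :=
  exist _ _ (limit_inv_subproof i x.1 x.2).

(** [qtrunc] and [fibre_inv] preserve [base], so the local trivialization of the family restricts to
    the fibre over 0. *)
Lemma limit_iso i : @iso_on K (Lim w) (prod_space (Lim w') (P1 K))
  (limit_trunc @^-1` limit_dom i) (limit_dom i `*` setT)
  (fun e => (limit_trunc e, fibre i (sval e))).
Proof.
have mt : morph_on setT limit_trunc.
  apply: morph_subspace.
  exact: (morph_comp (morph_sval _) (morph_qtrunc w) (fun _ _ => I)).
have oD : open (limit_trunc @^-1` limit_dom i).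
  by have := mt.1 _ (@limit_dom_open i); rewrite setTI.
exists (limit_inv i); split.
- apply: morph_pair; first by apply: morph_sub mt oD _.
  have ms := morph_sub (morph_sval (base @^-1` [set 0%R] : set (Fam w))) oD
    (fun _ _ => I).
  exact: (morph_comp ms (morph_fibre i) (fun _ h => h)).
- have oB : @open (prod_space (Lim w') (P1 K)) (limit_dom i `*` setT).
    have := (morph_fst (Lim w') (P1 K)).1 _ (@limit_dom_open i); rewrite setTI.
    congr open; apply/seteqP; by split=> -[y l] //= [].
  apply: morph_subspace; apply: morph_fibre_inv; last by move=> [y l] [].
    have mf := morph_sub (morph_fst (Lim w') (P1 K)) oB (fun _ _ => I).
    have ms := morph_sval (base @^-1` [set 0%R] : set (Fam w')).
    exact: (morph_comp mf ms (fun _ _ => I)).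
  by apply: morph_sub (morph_snd _ _) oB _.
- move=> e de; split=> //.
  case: e de => x hx dx; apply: eq_exist => /=; exact: fibre_invK.
move=> [y l] [/= dy _]; split.
  by rewrite /limit_dom /= qtrunc_fibre_inv.
congr pair; last by rewrite /= fibre_fibre_inv.
case: y dy => x hx dx; apply: eq_exist => /=; exact: qtrunc_fibre_inv.
Qed.

(* On the central fibre [straight i] and [straight j] differ by an element of T,
   which acts on P_a / B = P^1 diagonally. *)
Lemma limit_glue i j (e : Lim w) (v v' : punctured_plane K) :
  limit_dom i (limit_trunc e) -> limit_dom j (limit_trunc e) ->
  fibre j (sval e) = qproj (@collinear K) v ->
  sval v' = ((sval v).1, transition i j (sval (limit_trunc e)) * (sval v).2)%R ->
  fibre i (sval e) = qproj (@collinear K) v'.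
Proof.
move=> di dj + Ev; rewrite -[v]ppoint_sval -[v']ppoint_sval Ev.
move: Ev => _; case: e di dj => x hx; rewrite /limit_dom /=.
have [c xc] := qproj_surj x; rewrite -xc in hx *; rewrite /= base_proj in hx.
move=> di dj; rewrite !fibre_proj //; rewrite qtrunc_proj in di dj *.
have := (lt_bregmap i).1 _ di; have := (lt_bregmap j).1 _ dj.
rewrite transition_proj // /straight hx !Psi0.
move=> /borelP[tj [uj [Tj Uj ->]]] /borelP[ti [ui [Ti Ui ->]]].
rewrite !borel_torE // !quad_borel_tor //.
set p := (sval c).2 ord_max; have Pp : minpar G a p by exact: svalP c _.
(* At u = 0 the two straightened components differ by t_i t_j^-1 on the left. By [pcol_tor] this
   multiplies the second coordinate by alpha(t_i)^-1 alpha(t_j), the value of [transition i j]. *)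
have Tji := torusM Ti (torusV Tj).
have -> : tor G ti * p = tor G (fun k => ti k * (tj k)^-1)%R * (tor G tj * p).
  by rewrite (torM (km_axiomsP G)) //; [rewrite torV //; gsimp|exact: torusV].
move=> E; have := pcol_tor _ Tji (nonzero2_sval v) E.
rewrite characterM characterV invfM invrK => -> //.
apply: subgroupM (minpar_group (km_axiomsP G) a) _ Pp.
by apply: borel_minpar; exact: borel_maxtor.
Qed.

Lemma limit_stage : bott_tower r (Lim w') -> bott_tower r.+1 (Lim w).
Proof.
move=> bt; apply: (@BottStage K r _ limit_bundle (Lim w) limit_trunc) => //.
exists (fun i e => fibre i (sval e)); split=> [i|i j e v v']; first exact: limit_iso.
exact: limit_glue.
Qed.

End Stage.

Theorem bott_tower_toric_limit r (w : r.-tuple (simple D)) : bott_tower r (Lim w).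
Proof.
elim: r w => [|r IHr] w; first exact: limit_nil.
by apply: limit_stage; exact: IHr.
Qed.

End Family.

Theorem corollary4p4 (R : realType) (D : root_datum) (G : km_group R[i] D)
  (lambda : 'rV[int]_(rdim D)) (q : nat)
  (lambda_inj : forall u v : R[i], u != 0 -> v != 0 ->
     cochar lambda u = cochar lambda v -> u = v)
  (q_gt0 : (0 < q)%N)
  (root_lambda : forall (a : simple D) (u : R[i]), u != 0 ->
     character (simple_root a) (cochar lambda u) = u ^+ q)
  (r : nat) (w : r.-tuple (simple D)) :
  bott_tower r (toric_limit G lambda w).
Proof.
have pchar0 : [pchar R[i]] =i pred0 by exact: Num.Theory.pchar_num.
exact: (bott_tower_toric_limit G pchar0 q_gt0 root_lambda).
Qed.
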